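(* The point $q_*\in Q$ defined in the context is the unique equilibrium of the fluid dynamics, i.e., the unique point of $Q$ such that the constant function equal to it is a fluid trajectory. Furthermore, every fluid trajectory $\boldsymbol{q}$ satisfies $\lim_{t\to\infty}\|\boldsymbol{q}(t)-q_*\|_1=0$.
   Context: Let $\mathbb{N}=\{0,1,2,\dots\}$ and $m\geq 1$. For $i=1,\dots,m$ let $u_i:[0,\infty)\to\mathbb{R}$ be a concave function (only its values on $\mathbb{N}$ matter) and $\Delta(i,j)=u_i(j+1)-u_i(j)$ for $j\in\mathbb{N}$. Let $\mathcal{I}=\{1,\dots,m\}\times\mathbb{N}$ and $\mathcal{I}_+=\{(i,j)\in\mathcal{I}:j\geq 1\}$. Define a total order $\vartriangleleft$ on $\mathcal{I}_+$ by: $(i,j)\vartriangleleft(i',j')$ iff either $\Delta(i,j-1)<\Delta(i',j'-1)$, or $\Delta(i,j-1)=\Delta(i',j'-1)$ and $(i,j)$ is strictly larger than $(i',j')$ in the lexicographic order. Write $\vartriangleright$ for the reverse order and $\trianglerighteq$ for its non-strict version. Every nonempty subset of $\mathcal{I}_+$ has a largest element for $\vartriangleleft$. Let $\lambda,\mu>0$, $\rho=\lambda/\mu$, and let $\alpha(i)\in(0,1)$, $i=1,\dots,m$, with $\sum_i\alpha(i)=1$. $\ell_1$ is the space of absolutely summable elements of $\mathbb{R}^{\mathcal{I}}$ with norm $\|x\|_1=\sum_{(i,j)\in\mathcal{I}}|x(i,j)|$, and $Q=\{q\in[0,1]^{\mathcal{I}}\cap\ell_1: q(i,j+1)\leq q(i,j)\leq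 q(i,0)=\alpha(i)\text{ for all }(i,j)\in\mathcal{I}\}$. For $q\in Q$ let $\sigma(q)=\max\{(i,j)\in\mathcal{I}_+:q(i,j-1)>q(i,j)\}$, the maximum being with respect to $\vartriangleleft$. Define $\Lambda:Q\times\mathcal{I}_+\to\mathbb{R}$ by $\Lambda(q,i,j)=0$ if $(i,j)\vartriangleleft\sigma(q)$; $\Lambda(q,i,j)=\mu j[\alpha(i)-q(i,j+1)]$ if $(i,j)\vartriangleright\sigma(q)$; and $\Lambda(q,i,j)=\lambda-\sum_{(k,l)\vartriangleright\sigma(q)}\mu l[\alpha(k)-q(k,l+1)]$ if $(i,j)=\sigma(q)$. A function $\boldsymbol{q}:[0,\infty)\to Q$ is a fluid trajectory if all coordinate functions $\boldsymbol{q}(i,j)$ are absolutely continuous (on bounded intervals) and, for almost every $t$ with respect to Lebesgue measure, $\dot{\boldsymbol{q}}(i,j)=\Lambda(\boldsymbol{q},i,j)-\mu j[\boldsymbol{q}(i,j)-\boldsymbol{q}(i,j+1)]$ and $\Lambda(\boldsymbol{q},i,j)\geq 0$ for all $(i,j)\in\mathcal{I}_+$. Let $\sigma_*$ be the unique element of $\mathcal{I}_+$ with $\sum_{(i,j)\vartriangleright\sigma_*}\alpha(i)\leq\rho<\sum_{(i,j)\trianglerighteq\sigma_*}\alpha(i)$. Define $q_*(i,0)=\alpha(i)$ for all $i$ and, for $(i,j)\in\mathcal{I}_+$, $q_*(i,j)=0$ if $(i,j)\vartriangleleft\sigma_*$, $q_*(i,j)=\alpha(i)$ if $(i,j)\vartriangleright\sigma_*$,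 and $q_*(\sigma_* )=\rho-\sum_{(i,j)\vartriangleright\sigma_*}\alpha(i)$. *)

(* Defs.v *)
From mathcomp Require Import all_boot all_order all_algebra.
From mathcomp Require Import all_classical all_reals all_analysis.
Import Order.TTheory GRing.Theory Num.Theory.
Import numFieldNormedType.Exports.

Set Implicit Arguments.
Unset Strict Implicit.
Unset Printing Implicit Defensive.

Local Open Scope classical_set_scope.
Local Open Scope ring_scope.

(* The number m >= 1 of classes is written n.+1, and class i in {1, ..., m} is
   the ordinal i - 1 : 'I_n.+1.  A pair (i, j) is p with i = p.1, j = p.2. *)
Notation idx n := ('I_n.+1 * nat)%type.

Definition idx_pos (n : nat) : set (idx n) := [set p | (1 <= p.2)%N].

(* [u i] is meant on [0, +oo[ only; the values on negative reals are unused. *)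
Definition concave_on_nneg (R : realType) (u : R -> R) : Prop :=
  convex_function (`[0, +oo[%classic : set R) (fun x => - u x).

Definition Delta (R : realType) (n : nat) (u : 'I_n.+1 -> R -> R)
    (i : 'I_n.+1) (j : nat) : R := u i j.+1%:R - u i j%:R.

(* The order is only meaningful on [idx_pos]; ['I_n.+1 *l nat] carries the
   lexicographic order. *)
Definition tri (R : realType) (n : nat) (u : 'I_n.+1 -> R -> R)
    (p p' : idx n) : bool :=
  (Delta u p.1 p.2.-1 < Delta u p'.1 p'.2.-1) ||
  ((Delta u p.1 p.2.-1 == Delta u p'.1 p'.2.-1) &&
   ((p' : ('I_n.+1 *l nat)%type) < p)%O).

Definition above (R : realType) (n : nat) (u : 'I_n.+1 -> R -> R)
    (s : idx n) : set (idx n) := [set p | idx_pos p /\ tri u s p].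

Definition above_eq (R : realType) (n : nat) (u : 'I_n.+1 -> R -> R)
    (s : idx n) : set (idx n) := [set p | idx_pos p /\ (p == s \/ tri u s p)].

Definition l1norm (R : realType) (n : nat) (x : idx n -> R) : \bar R :=
  \esum_(p in [set: idx n]) `|x p|%:E.

Definition Q (R : realType) (n : nat) (alpha : 'I_n.+1 -> R) :
    set (idx n -> R) :=
  [set q | [/\ forall p, 0 <= q p <= 1,
               (l1norm q < +oo)%E &
               forall i j, [/\ q (i, j.+1) <= q (i, j), q (i, j) <= q (i, 0%N)
                             & q (i, 0%N) = alpha i]]].

(* The default value of [xget] is never used for q in Q: such a q is summable
   with q (i, 0) > 0, so that the set below is nonempty. *)
Definition sigma (R : realType) (n : nat) (u : 'I_n.+1 -> R -> R)
    (q : idx n -> R) : idx n :=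
  let D := [set p | idx_pos p /\ q (p.1, p.2.-1) > q p] in
  xget (ord0, 1%N) [set s | D s /\ forall p, D p -> p = s \/ tri u p s].

(* For q in Q the set [above u (sigma u q)] is finite: q (k, l) = alpha k for
   all its elements (k, l), and q is summable. *)
Definition Lambda (R : realType) (n : nat) (u : 'I_n.+1 -> R -> R)
    (lambda mu : R) (alpha : 'I_n.+1 -> R) (q : idx n -> R) (p : idx n) : R :=
  let s := sigma u q in
  if tri u s p then mu * p.2%:R * (alpha p.1 - q (p.1, p.2.+1))
  else if p == s then
    lambda - \sum_(k \in above u s) mu * k.2%:R * (alpha k.1 - q (k.1, k.2.+1))
  else 0.

Definition abs_continuous (R : realType) (f : R -> R) (a b : R) : Prop :=
  forall e : R, 0 < e -> exists2 d : R, 0 < d &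
    forall (N : nat) (x y : 'I_N -> R),
      (forall k, [/\ a <= x k, x k <= y k & y k <= b]) ->
      trivIset [set: 'I_N] (fun k => `]x k, y k[%classic) ->
      \sum_(k < N) (y k - x k) < d ->
      \sum_(k < N) `|f (y k) - f (x k)| < e.

(* Time is [0, +oo[; the values of [q] at negative times are irrelevant (they
   could only affect the two-sided derivative at the null set {0}). *)
Definition fluid_trajectory (R : realType) (n : nat) (u : 'I_n.+1 -> R -> R)
    (lambda mu : R) (alpha : 'I_n.+1 -> R) (q : R -> idx n -> R) : Prop :=
  [/\ forall t : R, 0 <= t -> Q alpha (q t),
      forall p (a b : R), 0 <= a -> a <= b -> abs_continuous (q ^~ p) a b &
      {ae (@lebesgue_measure R), forall t : R, 0 <= t ->
        forall p, idx_pos p ->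
          is_derive t (1 : R) (q ^~ p : R -> R)
            (Lambda u lambda mu alpha (q t) p
             - mu * p.2%:R * (q t p - q t (p.1, p.2.+1)))
          /\ 0 <= Lambda u lambda mu alpha (q t) p}].

Definition equilibrium (R : realType) (n : nat) (u : 'I_n.+1 -> R -> R)
    (lambda mu : R) (alpha : 'I_n.+1 -> R) (x : idx n -> R) : Prop :=
  Q alpha x /\ fluid_trajectory u lambda mu alpha (fun=> x).

(* The sums are taken in the extended reals since [above u s] can be infinite
   when some [Delta u i] is bounded below.  The characterizing property holds
   for exactly one element, so the default value of [xget] is never used. *)
Definition sigma_star (R : realType) (n : nat) (u : 'I_n.+1 -> R -> R)
    (alpha : 'I_n.+1 -> R) (rho : R) : idx n :=
  xget (ord0, 1%N) [set s | [/\ idx_pos s,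
    (\esum_(p in above u s) (alpha p.1)%:E <= rho%:E)%E &
    (rho%:E < \esum_(p in above_eq u s) (alpha p.1)%:E)%E]].

(* [above u (sigma_star u alpha rho)] is finite: the sum of the alpha p.1 over
   this set is at most rho. *)
Definition q_star (R : realType) (n : nat) (u : 'I_n.+1 -> R -> R)
    (alpha : 'I_n.+1 -> R) (rho : R) (p : idx n) : R :=
  let s := sigma_star u alpha rho in
  if p.2 == 0%N then alpha p.1
  else if tri u s p then alpha p.1
  else if p == s then rho - \sum_(k \in above u s) alpha k.1
  else 0.

(* Main.v *)
Require Import Defs.
From mathcomp Require Import all_boot all_order all_algebra.
From mathcomp Require Import all_classical all_reals all_analysis.
From mathcomp Require Import ring lra.
Import Order.TTheory GRing.Theory Num.Theory.
Import numFieldNormedType.Exports.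

(** Let [A] be the set of indices above [sigma_star], [B] the set obtained by
    adding [sigma_star] itself, and let [aA <= rho < aB] be the sums of the
    [alpha p.1] over [A] and [B].  Three exponential estimates give convergence.
    - The total mass [S] of [q] over the indices with [j >= 1] formally solves
      [S' = lambda - mu S], so that it is at most [rho + O(exp (- mu t))].
      Summing over finitely many [j] only leaves a boundary term; it is made
      small by weights [w j] of finite support such that
      [j (w j - w j.+1) <= eps], which exist because the harmonic series
      diverges.
    - If [C] is a finite upper set for the order and [V] is the mass over [C],
      then [V' >= lambda - mu V] as long as [sigma q] is in [C]; otherwise [C]
      is full and [V' = 0].  For [C = A] this makes the deficit [aA - V] decay
      like [exp (- mu t)].
    - For [C = B], [V <= S] is eventually smaller than [aB], so that [B] is not
      full and [sigma q] stays in [B]; hence [rho - V] is eventually at most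
      [O(exp (- mu t))].
    Together these bound the distance to [q_star]: the mass in [A] tends to
    [aA], the mass in [B] to [rho], and the mass outside [B] to [0].

    The differential inequalities are integrated by a Gronwall lemma for
    absolutely continuous functions, which rests on the fact that such a
    function is nonincreasing if its derivative is almost everywhere
    nonpositive.  Uniqueness of the equilibrium follows from convergence. *)

Set Implicit Arguments.
Unset Strict Implicit.
Unset Printing Implicit Defensive.

Local Open Scope classical_set_scope.
Local Open Scope ring_scope.

(** * Absolutely continuous functions *)

(** Apply the local hypothesis at the supremum of the points of [a, b] satisfying [P]: some such
    point lies just to its left, so [P] passes to the supremum and, were it less than [b], strictly
    beyond it. The two-sided form matches what a derivative or an open neighbourhood at [x]
    provides. *)
Lemma real_induction (R : realType) (a b : R) (P : R -> Prop) :
  a <= b -> P a ->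
  (forall x, a <= x <= b -> exists2 r : R, 0 < r &
    forall y z, a <= y -> y <= x -> x <= z -> z <= b ->
      x - r < y -> z < x + r -> P y -> P z) ->
  P b.
Proof.
move=> leab Pa loc.
pose S := [set x | a <= x <= b /\ P x].
have Sa : S a by split=> //; rewrite lexx.
have hS : has_sup S by split; [exists a | exists b => x [/andP[]]].
have abs : a <= sup S <= b.
  apply/andP; split; first exact: (ub_le_sup (proj2 hS)).
  by apply: ge_sup; [exists a | move=> x [/andP[]]].
have [r r0 hr] := loc _ abs.
have [y [/andP[ay yb] Py] hy] := sup_adherent r0 hS.
have ys : y <= sup S by apply: (ub_le_sup (proj2 hS)); split=> //; rewrite ay.
have Pz z : sup S <= z -> z <= b -> z < sup S + r -> P z.
  by move=> sz zb zr; apply: (hr y).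
have [bs|sb] := leP b (sup S).
  by apply: Pz => //; move/andP: abs => [? ?]; lra.
exfalso.
pose z := Num.min b (sup S + r / 2).
have sz : sup S < z by rewrite /z lt_min sb /=; lra.
have zb : z <= b by rewrite /z ge_min lexx.
have zr : z < sup S + r by rewrite /z gt_min; apply/orP; right; lra.
have : z <= sup S.
  apply: (ub_le_sup (proj2 hS)); split; last by apply: Pz => //; exact: ltW.
  by move/andP: abs => [? ?]; rewrite zb andbT; lra.
by rewrite leNgt sz.
Qed.

(** Turns a sorted list of intervals into the kind of indexed family that [abs_continuous]
    quantifies over; the length bound is additivity of Lebesgue measure. *)
Lemma pairwise_disjoint_length (R : realType) (l : seq (R * R)) (U : set R) :
  (forall p, p \in l -> p.1 <= p.2) ->
  (forall p, p \in l -> `]p.1, p.2[%classic `<=` U) -> measurable U ->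
  pairwise (fun p q => p.2 <= q.1) l ->
  trivIset [set: 'I_(size l)]
    (fun k => `](nth (0, 0) l k).1, (nth (0, 0) l k).2[%classic) /\
  ((\sum_(p <- l) (p.2 - p.1))%:E <= lebesgue_measure U)%E.
Proof.
move=> hl hU mU pl.
set I := fun k : 'I_(size l) => _.
have tI : trivIset [set: 'I_(size l)] I.
  apply/trivIsetP => i j _ _ ij.
  wlog lij : i j ij / (i < j)%N.
    move=> h; have [|] := ltnP i j; first exact: h.
    rewrite leq_eqVlt => /orP[/eqP e|ji]; last by rewrite setIC h// eq_sym.
    by move: ij; rewrite (_ : i = j) ?eqxx//; exact/val_inj.
  apply/seteqP; split => // x []; rewrite /I /= !in_itv /=.
  move=> /andP[_ x1] /andP[x2 _].
  move/(pairwiseP (0, 0)): pl => /(_ i j (ltn_ord i) (ltn_ord j) lij) /= h.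
  by have := lt_trans x2 x1; rewrite ltNge h.
split=> //.
have -> : (\sum_(p <- l) (p.2 - p.1))%:E =
    (\sum_(k < size l) lebesgue_measure (I k))%E.
  rewrite -sumEFin (big_nth (0, 0)) big_mkord; apply: eq_bigr => k _.
  rewrite /I lebesgue_measure_itv /= lte_fin.
  have := hl _ (mem_nth (0, 0) (ltn_ord k)).
  by case: ltgtP => // ->; rewrite subrr.
rewrite -measure_semi_additive_ord//; last first.
- by apply: bigsetU_measurable => k _; exact: measurable_itv.
- by move=> k; exact: measurable_itv.
apply: le_measure; rewrite ?inE//.
  by apply: bigsetU_measurable => k _; exact: measurable_itv.
elim/big_ind : _ => [x []|X Y XU YU x [/XU|/YU]|k _]//.
by apply: hU; apply: mem_nth.
Qed.

(** The straddle estimate: as [y] and [z] lie on either side of [x], the two first-order errors add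
    up to exactly [e * (z - y)]. *)
Lemma is_derive_local_bound (R : realType) (f : R -> R) (x d e : R) :
  is_derive x (1 : R) f d -> d <= 0 -> 0 < e ->
  exists2 r : R, 0 < r & forall y z, y <= x -> x <= z ->
    x - r < y -> z < x + r -> f z - f y <= e * (z - y).
Proof.
move=> df d0 e0.
have /cvgrPdist_lt /(_ e e0) :
    h^-1 *: ((f \o shift x) (h *: 1) - f x) @[h --> 0^'] --> d.
  by rewrite -(derive_val (is_derive := df)); exact: ex_derive.
case=> r /= r0 hr; exists r => //.
have hx w : `|w - x| < r -> `|f w - f x - d * (w - x)| <= e * `|w - x|.
  move=> wr; have [->|wx] := eqVneq w x.
    by rewrite !subrr mulr0 subrr normr0 mulr0.
  have wx0 : w - x != 0 by rewrite subr_eq0.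
  have := hr (w - x); rewrite /= sub0r normrN => /(_ wr wx0).
  rewrite /= /shift /= [_ *: 1]mulr1 subrK /GRing.scale /= => h.
  have -> : f w - f x - d * (w - x) =
      - ((d - (w - x)^-1 * (f w - f x)) * (w - x)).
    by field.
  by rewrite normrN normrM ler_wpM2r // ltW.
move=> y z yx xz yr zr.
have := hx y; rewrite distrC ger0_norm ?subr_ge0// => /(_ _)/wrap[]; first lra.
rewrite ler_norml => /andP[+ _].
have := hx z; rewrite ger0_norm ?subr_ge0// => /(_ _)/wrap[]; first lra.
rewrite ler_norml => /andP[_ +].
have : d * (z - y) <= 0 by rewrite mulr_le0_ge0// subr_ge0 (le_trans yx).
lra.
Qed.

(** Cover the exceptional null set [N] by an open [U] of small measure and chain along [a, b] by
    real induction. Around a point outside [N] the increment is at most [e] times the length; around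
    a point of [N] the interval lies in [U] and is appended to the list [l]. Absolute continuity
    bounds the increments over [l] by [e]. *)
Lemma ac_nonincreasing (R : realType) (f : R -> R) (a b : R) :
  a <= b -> abs_continuous f a b ->
  {ae (@lebesgue_measure R), forall t, a <= t <= b ->
     exists2 d, is_derive t (1 : R) f d & d <= 0} ->
  f b <= f a.
Proof.
move=> ab acf aef; apply/ler_addgt0Pr => e' e'0.
(* The ordinary steps cost [e * (b - a)] in total and the recorded ones at most [e]. *)
pose e := e' / (b - a + 1).
have e0 : 0 < e by rewrite divr_gt0//; lra.
have [dl dl0 acd] := acf e e0.
case: aef => N [mN N0 hN].
have [U [oU NU Udl]] : exists U : set R,
    [/\ open U, N `<=` U & (lebesgue_measure U < dl%:E)%E].
  (* Regularity bounds the measure of [U] minus [N]; putting back the null set [N] changes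
     nothing. *)
  have [|U [oU NU Udl]] := @lebesgue_regularity_outer R N dl mN _ dl0.
    by move: N0 => /= ->.
  exists U; split=> //; apply: le_lt_trans Udl.
  have mU : measurable U by exact: measurable_realfun.open_measurable.
  rewrite -[in leLHS](setDUK NU) setUC.
  apply: le_trans (measureU2 _ _ _) _ => //.
    exact: measurableD.
  by move: N0 => /= ->; rewrite adde0.
have mU : measurable U by exact: measurable_realfun.open_measurable.
pose P x := exists l : seq (R * R),
  [/\ pairwise (fun p q => p.2 <= q.1) l,
      forall p, p \in l -> [/\ a <= p.1, p.1 <= p.2 & p.2 <= x],
      forall p, p \in l -> `]p.1, p.2[%classic `<=` U &
      f x - f a <= e * (x - a) + \sum_(p <- l) `|f p.2 - f p.1|].
have : P b.
  apply: (@real_induction _ _ _ P ab).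
    by exists [::]; split=> //; rewrite !subrr mulr0 big_nil addr0.
  move=> x axb.
  have [r r0 hr] : exists2 r : R, 0 < r & forall y z, y <= x -> x <= z ->
      x - r < y -> z < x + r ->
      f z - f y <= e * (z - y) \/ `]y, z[%classic `<=` U.
    have [xN|xN] := pselect (N x).
      have [r /= r0 hr] : nbhs x U.
        by apply: open_nbhs_nbhs; split=> //; exact: NU.
      exists r => // y z yx xz yr zr; right => w /=.
      rewrite in_itv/= => /andP[yw wz].
      by apply: hr; rewrite /ball /= ltr_norml; apply/andP; split; lra.
    have [d df d0] : exists2 d, is_derive x (1 : R) f d & d <= 0.
      by apply: contrapT => h; apply: xN; apply: hN => /= /(_ axb).
    have [r r0 hr] := is_derive_local_bound df d0 e0.
    by exists r => // y z *; left; exact: hr.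
  exists r => // y z ay yx xz zb yr zr [l [pl hl lU fl]].
  have [h|h] := hr _ _ yx xz yr zr.
    exists l; split=> //; last by lra.
    by move=> p /hl[? ? ?]; split=> //; lra.
  exists (rcons l (y, z)); split.
  - rewrite pairwise_rcons pl andbT; apply/allP => p /hl[_ _] /=.
    by [].
  - move=> p; rewrite mem_rcons inE => /orP[/eqP ->/=|/hl[? ? ?]]; split; lra.
  - by move=> p; rewrite mem_rcons inE => /orP[/eqP ->//|/lU].
  - rewrite -cats1 big_cat big_seq1/=.
    have := ler_norm (f z - f y).
    have : 0 <= e * (z - y) by rewrite mulr_ge0 ?(ltW e0)// subr_ge0; lra.
    lra.
case=> l [pl hl lU fl].
have [|tl sl] := pairwise_disjoint_length _ lU mU pl.
  by move=> p /hl[].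
have /= := acd (size l) (fun k => (nth (0, 0) l k).1)
  (fun k => (nth (0, 0) l k).2).
have sE F : \sum_(k < size l) F (nth (0, 0) l k) = \sum_(p <- l) F p :> R.
  by rewrite (big_nth (0, 0)) big_mkord.
rewrite (sE (fun p => p.2 - p.1)) (sE (fun p => `|f p.2 - f p.1|)).
move=> /(_ _ tl)/wrap[].
  by move=> k; have := hl _ (mem_nth (0, 0) (ltn_ord k)).
move=> /(_ _)/wrap[].
  by rewrite -lte_fin; exact: le_lt_trans Udl.
have : e * (b - a + 1) = e' by rewrite /e; field; lra.
lra.
Qed.

(** One criterion for scalar multiples, for subtracting a linear function, and for the product with
    an exponential in [ac_gronwall]. *)
Lemma ac_dominated (R : realType) (f g : R -> R) (a b C L : R) :
  abs_continuous f a b -> 0 <= C -> 0 <= L ->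
  (forall x y, a <= x -> x <= y -> y <= b ->
     `|g y - g x| <= C * `|f y - f x| + L * (y - x)) ->
  abs_continuous g a b.
Proof.
move=> acf C0 L0 gf e e0.
have C1 : 0 < 2 * (C + 1) by lra.
have L1 : 0 < 2 * (L + 1) by lra.
have [d d0 acd] := acf (e / (2 * (C + 1))) (divr_gt0 e0 C1).
exists (Num.min d (e / (2 * (L + 1)))); first by rewrite lt_min d0 divr_gt0.
move=> N x y xy txy; rewrite lt_min => /andP[sd sL].
have := acd N x y xy txy sd.
set S := (X in X < _) => hS.
apply: (@le_lt_trans _ _ (C * S + L * \sum_(k < N) (y k - x k))).
  rewrite /S !mulr_sumr -big_split /=; apply: ler_sum => k _.
  by have [? ? ?] := xy k; apply: gf.
have S0 : 0 <= S by apply: sumr_ge0.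
have s0 : 0 <= \sum_(k < N) (y k - x k).
  by apply: sumr_ge0 => k _; have [_ ? _] := xy k; rewrite subr_ge0.
rewrite ltr_pdivlMr// in hS; rewrite ltr_pdivlMr// in sL.
nra.
Qed.

Lemma acZ (R : realType) (f : R -> R) (k a b : R) :
  abs_continuous f a b -> abs_continuous (fun t => k * f t) a b.
Proof.
move=> acf; apply: (ac_dominated acf (normr_ge0 k) (lexx 0)) => x y _ _ _.
by rewrite -mulrBr normrM mul0r addr0.
Qed.

Lemma acD (R : realType) (f g : R -> R) (a b : R) :
  abs_continuous f a b -> abs_continuous g a b ->
  abs_continuous (fun t => f t + g t) a b.
Proof.
move=> acf acg e e0.
have e2 : 0 < e / 2 by lra.
have [d1 d10 h1] := acf _ e2; have [d2 d20 h2] := acg _ e2.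
exists (Num.min d1 d2); first by rewrite lt_min d10.
move=> N x y xy txy; rewrite lt_min => /andP[s1 s2].
have := h1 N x y xy txy s1; have := h2 N x y xy txy s2.
suff : \sum_(k < N) `|f (y k) + g (y k) - (f (x k) + g (x k))| <=
  \sum_(k < N) `|f (y k) - f (x k)| + \sum_(k < N) `|g (y k) - g (x k)| by lra.
rewrite -big_split; apply: ler_sum => k _ /=.
by rewrite opprD addrACA ler_normD.
Qed.

Lemma ac_cst (R : realType) (k a b : R) : abs_continuous (fun=> k) a b.
Proof.
move=> e e0; exists 1 => // N x y _ _ _.
by rewrite big1// => i _; rewrite subrr normr0.
Qed.

Lemma ac_sum (R : realType) (I : Type) (r : seq I) (f : I -> R -> R) (a b : R) :
  (forall i, abs_continuous (f i) a b) ->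
  abs_continuous (fun t => \sum_(i <- r) f i t) a b.
Proof.
move=> acf; elim: r => [|i r ih].
  by under eq_fun do rewrite big_nil; exact: ac_cst.
under eq_fun do rewrite big_cons.
exact: (acD (acf i) ih).
Qed.

Lemma is_derive_sum_seq (R : realType) (I : eqType) (r : seq I)
    (f : I -> R -> R) (df : I -> R) (t : R) :
  (forall i, i \in r -> is_derive t (1 : R) (f i) (df i)) ->
  is_derive t (1 : R) (fun t => \sum_(i <- r) f i t) (\sum_(i <- r) df i).
Proof.
elim: r => [_|i r ih h].
  by under eq_fun do rewrite big_nil; rewrite big_nil; exact: is_derive_cst.
under eq_fun do rewrite big_cons; rewrite big_cons.
apply: is_deriveD; first by apply: h; rewrite mem_head.
by apply: ih => k kr; apply: h; rewrite inE kr orbT.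
Qed.

Lemma ac_linear_growth (R : realType) (f : R -> R) (c a b : R) :
  a <= b -> abs_continuous f a b ->
  {ae (@lebesgue_measure R), forall t, a <= t <= b ->
     exists2 d, is_derive t (1 : R) f d & d <= c} ->
  f b <= f a + c * (b - a).
Proof.
move=> ab acf aef.
suff : f b - c * b <= f a - c * a by lra.
apply: (@ac_nonincreasing _ (fun t => f t - c * t) _ _ ab).
  apply: (ac_dominated acf ler01 (normr_ge0 c)) => x y _ xy _.
  rewrite (_ : _ - _ = (f y - f x) - c * (y - x)); last by ring.
  rewrite (le_trans (ler_normB _ _))// mul1r normrM.
  by rewrite [`|y - x|]ger0_norm// subr_ge0.
case: aef => N [mN N0 hN]; exists N; split=> //; apply: subset_trans hN.
apply: subsetC => t /= h /h[d df dle].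
exists (d - c); last by rewrite subr_le0.
have := is_deriveB df (is_deriveZ c (is_derive_id t 1)).
by move/is_derive_eq; apply; rewrite /GRing.scale /= mulr1.
Qed.

Lemma expR_lipschitz (R : realType) (x y : R) :
  x <= y -> 0 <= expR y - expR x <= expR y * (y - x).
Proof.
move=> xy; apply/andP; split; first by rewrite subr_ge0 ler_expR.
have := expR_ge1Dx (x - y); rewrite expRB ler_pdivlMr ?expR_gt0//.
lra.
Qed.

(** The integrating factor [expR (mu * (t - a))] makes its product with [f t - c] nonincreasing. The
    bound [M] enters the constant that shows this product to be absolutely continuous. *)
Lemma ac_gronwall (R : realType) (f : R -> R) (mu c M a b : R) :
  0 <= mu -> a <= b -> abs_continuous f a b ->
  (forall t, a <= t <= b -> `|f t| <= M) ->
  {ae (@lebesgue_measure R), forall t, a <= t <= b ->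
     exists2 d, is_derive t (1 : R) f d & d <= mu * (c - f t)} ->
  f b <= c + (f a - c) * expR (- (mu * (b - a))).
Proof.
move=> mu0 ab acf fM aef.
pose g t := expR (mu * (t - a)) * (f t - c).
suff : g b <= g a.
  rewrite /g subrr mulr0 expR0 mul1r -ler_pdivlMl ?expR_gt0// -expRN.
  lra.
have M0 : 0 <= M by rewrite (le_trans _ (fM a _)) ?normr_ge0// lexx.
pose E := expR (mu * (b - a)).
have leE t : t <= b -> expR (mu * (t - a)) <= E.
  by move=> tb; rewrite ler_expR ler_wpM2l// lerB.
have E1 : 0 <= E by rewrite expR_ge0.
apply: (ac_nonincreasing ab).
  apply: (@ac_dominated _ f _ a b E (E * mu * (M + `|c|)) acf E1).
    by rewrite !mulr_ge0 ?addr_ge0.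
  move=> x y ax xy yb.
  have -> : g y - g x = expR (mu * (y - a)) * (f y - f x) +
     (expR (mu * (y - a)) - expR (mu * (x - a))) * (f x - c).
    by rewrite /g; ring.
  apply: le_trans (ler_normD _ _) _; rewrite !normrM; apply: lerD.
    by rewrite ler_wpM2r// ger0_norm ?expR_ge0// leE.
  have /expR_lipschitz/andP[h1 h2] : mu * (x - a) <= mu * (y - a).
    by rewrite ler_wpM2l// lerB.
  rewrite (ger0_norm h1).
  have h3 : `|f x - c| <= M + `|c|.
    by rewrite (le_trans (ler_normB _ _))// lerD// fM// ax (le_trans xy).
  have -> : E * mu * (M + `|c|) * (y - x) =
      (E * (mu * (y - x))) * (M + `|c|) by ring.
  apply: ler_pM => //; apply: (le_trans h2).
  rewrite -mulrBr opprB addrA subrK; apply: ler_wpM2r; last exact: leE.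
  by rewrite mulr_ge0// subr_ge0.
case: aef => N [mN N0 hN]; exists N; split=> //; apply: subset_trans hN.
apply: subsetC => t /= h /h[d df dle].
exists (expR (mu * (t - a)) * (mu * (f t - c) + d)).
  have h1 : is_derive t (1 : R) (fun t => mu * (t - a)) mu.
    have := is_deriveZ mu (is_deriveB (is_derive_id t 1) (is_derive_cst a t 1)).
    by move/is_derive_eq; apply; rewrite subr0 /GRing.scale /= mulr1.
  have h2 := @is_derive1_comp _ expR _ t _ _ (is_derive_expR (mu * (t - a))) h1.
  have h3 := is_deriveB df (is_derive_cst c t 1).
  have := is_deriveM h2 h3.
  move/is_derive_eq; apply.
  rewrite /GRing.scale /= (_ : (f - cst c) t = f t - c)//; ring.
by rewrite mulr_ge0_le0 ?expR_ge0//; lra.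
Qed.

(** * The order on indices and finite sums *)

Lemma concave_midpoint (R : realType) (f : R -> R) (x y : R) :
  concave_on_nneg f -> 0 <= x -> 0 <= y -> (f x + f y) / 2 <= f ((x + y) / 2).
Proof.
move=> fc x0 y0.
have h1 : (0 : R) <= 2^-1 by lra.
have h2 : 2^-1 <= (1 : R) by lra.
have := fc (Itv01 h1 h2) x y.
rewrite !inE /= !in_itv /= !andbT => /(_ x0 y0).
have avg (v w : R^o) : (conv (Itv01 h1 h2) v w : R) = (v + w) / 2.
  by rewrite convRE /= /unstable.onem; field.
have <- := avg x y; have := avg (- f x) (- f y).
by move=> /= ->; lra.
Qed.

Section order.
Context {R : realType} {n : nat} (u : 'I_n.+1 -> R -> R).
Implicit Types p q r s : idx n.

Lemma tri_irr p : tri u p p = false.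
Proof. by rewrite /tri !ltxx andbF. Qed.

Lemma tri_trans q p r : tri u p q -> tri u q r -> tri u p r.
Proof.
rewrite /tri => /orP[h1|/andP[/eqP -> h1]] /orP[h2|/andP[/eqP e2 h2]].
- by rewrite (lt_trans h1 h2).
- by rewrite -e2 h1.
- by rewrite h2.
- by rewrite e2 eqxx (lt_trans h2 h1) orbT.
Qed.

Lemma tri_total p q : p != q -> tri u p q || tri u q p.
Proof.
move=> pq; rewrite /tri; case: ltgtP => //= e.
have := @lt_total _ ('I_n.+1 *l nat)%type p q pq.
by rewrite orbC.
Qed.

Lemma triN p q : ~~ tri u p q = (q == p) || tri u q p.
Proof.
have [->|qp] := eqVneq q p; first by rewrite tri_irr.
apply/idP/idP => /= [h|h].
  by have := tri_total qp; rewrite (negbTE h) orbF.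
by apply/negP => /(tri_trans h); rewrite tri_irr.
Qed.

Hypothesis u_concave : forall i, concave_on_nneg (u i).

(** Concavity makes [Delta u i] nonincreasing, and ties put the lexicographically larger index
    lower. Within a class the order thus reverses that of the levels. *)
Lemma tri_succ i j : tri u (i, j.+2) (i, j.+1).
Proof.
rewrite /tri /=; have : Delta u i j.+1 <= Delta u i j.
  rewrite /Delta.
  have := concave_midpoint (u_concave i) (ler0n _ j) (ler0n _ j.+2).
  have -> : (j%:R + j.+2%:R) / 2 = j.+1%:R :> R by rewrite -!natr1; field.
  lra.
rewrite le_eqVlt => /orP[/eqP ->|->//]; rewrite eqxx ltxx /=.
by rewrite ltEprodlexi /= lexx /= ltEnat /= ltnS.
Qed.

Lemma tri_leq i j k : (0 < j)%N -> (j < k)%N -> tri u (i, k) (i, j).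
Proof.
case: j => // j _; elim: k => // k ih.
rewrite ltnS leq_eqVlt => /orP[/eqP <-|jk]; first exact: tri_succ.
apply: (@tri_trans (i, k)); last exact: ih.
by case: k jk {ih} => // k _; exact: tri_succ.
Qed.

(** In one class the largest element is the one of least level, which exists by well-foundedness of
    [nat]; the induction then compares the finitely many classes. *)
Lemma tri_max (D : set (idx n)) :
  D `<=` idx_pos (n := n) -> D !=set0 ->
  exists2 s, D s & forall p, D p -> p = s \/ tri u p s.
Proof.
move=> Dpos [p0 Dp0].
suff H (r : seq 'I_n.+1) : (exists2 p, D p & p.1 \in r) ->
    exists2 s, D s & forall p, D p -> p.1 \in r -> p = s \/ tri u p s.
  have [|s Ds hs] := H (index_enum 'I_n.+1).
    by exists p0 => //; rewrite mem_index_enum.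
  by exists s => // p Dp; apply: hs => //; rewrite mem_index_enum.
elim: r => [[p _]|i r ih]; first by rewrite in_nil.
have [[j Dj]|nDi] := pselect (exists j, D (i, j)); last first.
  have nDi' p : D p -> p.1 \in i :: r -> p.1 \in r.
    rewrite inE => Dp /orP[/eqP e|//]; exfalso; apply: nDi; exists p.2.
    by rewrite -e -surjective_pairing.
  case=> p Dp /(nDi' _ Dp) pr; have [|s Ds hs] := ih; first by exists p.
  by exists s => // q Dq /(nDi' _ Dq); exact: hs.
have ex : exists j, `[< D (i, j) >] by exists j; apply/asboolP.
pose j0 := ex_minn ex.
have [Dj0 hj0] : D (i, j0) /\ forall k, D (i, k) -> (j0 <= k)%N.
  rewrite /j0; case: ex_minnP => m /asboolP Dm hm; split=> // k Dk.
  by apply: hm; apply/asboolP.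
have hi p : D p -> p.1 = i -> p = (i, j0) \/ tri u p (i, j0).
  case: p => i' k Dp /= e; rewrite e in Dp *.
  have := hj0 _ Dp; rewrite leq_eqVlt => /orP[/eqP <-|h]; first by left.
  by right; apply: tri_leq => //; exact: (Dpos _ Dj0).
move=> _; have [exr|nexr] := pselect (exists2 p, D p & p.1 \in r); last first.
  exists (i, j0) => // p Dp; rewrite inE => /orP[/eqP/(hi _ Dp)//|pr].
  by exfalso; apply: nexr; exists p.
have [s Ds hs] := ih exr.
have [e|] := eqVneq s (i, j0).
  exists s => // p Dp; rewrite inE => /orP[/eqP|]; last exact: hs.
  by rewrite e; exact: hi.
move=> /tri_total /orP[h|h].
  exists (i, j0) => // p Dp; rewrite inE => /orP[/eqP/(hi _ Dp)//|/(hs _ Dp)].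
  by move=> [->|ps]; right => //; exact: tri_trans h.
exists s => // p Dp; rewrite inE => /orP[/eqP/(hi _ Dp)|/(hs _ Dp)//].
by move=> [->|ps]; right => //; exact: tri_trans h.
Qed.

End order.

(** The positive indices truncated at level [J]. Sums over a set [A] are written as box sums with
    weight [(A p)%:R], so that restricting the set, weighting and changing [J] all act on
    expressions of one shape. *)
Definition boxs (n J : nat) : seq (idx n) :=
  [seq (i, j.+1) | i <- index_enum 'I_n.+1, j <- index_iota 0 J].

Lemma big_boxs (V : nmodType) (n J : nat) (f : idx n -> V) :
  \sum_(p <- boxs n J) f p = \sum_(i < n.+1) \sum_(j < J) f (i, j.+1).
Proof.
by rewrite /boxs big_allpairs_dep; apply: eq_bigr => i _; rewrite big_mkord.
Qed.

Lemma mem_boxs (n J : nat) (p : idx n) : (p \in boxs n J) = (0 < p.2 <= J)%N.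
Proof.
case: p => i j /=; apply/allpairsP/idP => [[[i' j'] /= []]|].
  by rewrite mem_index_iota => _ h [_ ->].
case: j => // j h; exists (i, j); split=> //=; first exact: mem_index_enum.
by rewrite mem_index_iota.
Qed.

Lemma boxs_uniq (n J : nat) : uniq (boxs n J).
Proof.
apply: allpairs_uniq; rewrite ?index_enum_uniq ?iota_uniq//.
by move=> [i j] [i' j'] _ _ [-> ->].
Qed.

Lemma sum_boxs_fsbig (R : realType) (n J : nat) (A : pred (idx n))
    (f : idx n -> R) :
  (forall p, idx_pos p -> A p -> (p.2 <= J)%N) ->
  \sum_(p \in [set p | idx_pos p /\ A p]) f p =
  \sum_(p <- boxs n J) (A p)%:R * f p.
Proof.
move=> AJ.
transitivity (\sum_(p <- [seq p <- boxs n J | A p]) f p).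
  rewrite [RHS]fsbig_seq ?filter_uniq ?boxs_uniq//; apply: eq_fsbigl.
  apply/seteqP; split=> p /=; rewrite mem_filter mem_boxs.
    by move=> [p0 Ap]; rewrite Ap (AJ _ p0 Ap) andbT.
  by move=> /and3P[].
rewrite big_filter big_mkcond; apply: eq_bigr => p _.
by case: ifP => _; rewrite ?mul1r ?mul0r.
Qed.

Lemma sum_boxs_pred1 (R : realType) (n J : nat) (s : idx n) (f : idx n -> R) :
  (0 < s.2 <= J)%N -> \sum_(p <- boxs n J) (p == s)%:R * f p = f s.
Proof.
rewrite -mem_boxs => sJ; rewrite (bigD1_seq s) ?boxs_uniq//= eqxx mul1r.
by rewrite big1 ?addr0// => p /negbTE ->; rewrite mul0r.
Qed.

(** Every finite set of indices is contained in a box, up to level 0. *)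
Lemma esum_le_boxs (R : realType) (n : nat) (A : pred (idx n))
    (f : idx n -> R) (c : R) :
  (forall p, 0 <= f p) ->
  (forall J, \sum_(p <- boxs n J) (A p)%:R * f p <= c) ->
  (\esum_(p in [set p | idx_pos p /\ A p]) (f p)%:E <= c%:E)%E.
Proof.
move=> f0 fc; apply: ub_ereal_sup => _ [F [finF FA] <-].
rewrite fsumEFin// lee_fin.
have [J hJ] : exists J, forall p, F p -> (p.2 <= J)%N.
  have /finite_seqP[r ->] := finF.
  by exists (\max_(p <- r) p.2)%N => p /= pr; exact: leq_bigmax_seq.
apply: le_trans (fc J).
have -> : F = [set p | idx_pos p /\ `[< F p >]].
  apply/seteqP; split=> p /= => [Fp|[_ /asboolP//]].
  by split; [case: (FA _ Fp)|exact/asboolP].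
rewrite (@sum_boxs_fsbig _ _ J (fun p => `[< F p >])); last first.
  by move=> p _ /asboolP /hJ.
apply: ler_sum => p _; rewrite ler_wpM2r//.
by case: asboolP => [/FA[_ ->]|]//; rewrite ler0n.
Qed.

Lemma boxs_le_esum (R : realType) (n J : nat) (A : pred (idx n))
    (f : idx n -> R) :
  (forall p, 0 <= f p) ->
  ((\sum_(p <- boxs n J) (A p)%:R * f p)%:E <=
   \esum_(p in [set p | idx_pos p /\ A p]) (f p)%:E)%E.
Proof.
move=> f0; apply: esum_ge.
exists [set` [seq p <- boxs n J | A p]].
  split; first exact: finite_seq.
  by move=> p /=; rewrite mem_filter mem_boxs => /and3P[].
rewrite -fsbig_seq ?filter_uniq ?boxs_uniq// sumEFin lee_fin.
rewrite big_filter [in leRHS]big_mkcond; apply: ler_sum => p _.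
by case: ifP => _; rewrite ?mul1r ?mul0r.
Qed.

(** * Rates at a state of Q *)

Lemma sum_boxs_enlarge (R : realType) (n J J' : nat) (A : pred (idx n))
    (f : idx n -> R) :
  (J <= J')%N -> (forall p, idx_pos p -> A p -> (p.2 <= J)%N) ->
  \sum_(p <- boxs n J) (A p)%:R * f p = \sum_(p <- boxs n J') (A p)%:R * f p.
Proof.
move=> JJ' AJ; rewrite -!sum_boxs_fsbig// => p p0 Ap.
exact: leq_trans (AJ p p0 Ap) JJ'.
Qed.

Lemma ler_sum_boxs (R : realType) (n J : nat) (f g : idx n -> R) :
  (forall p, idx_pos p -> (p.2 <= J)%N -> f p <= g p) ->
  \sum_(p <- boxs n J) f p <= \sum_(p <- boxs n J) g p.
Proof.
move=> fg; rewrite big_seq [leRHS]big_seq; apply: ler_sum => p.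
by rewrite mem_boxs => /andP[]; exact: fg.
Qed.

Lemma eq_sum_boxs (R : realType) (n J : nat) (f g : idx n -> R) :
  (forall p, idx_pos p -> (p.2 <= J)%N -> f p = g p) ->
  \sum_(p <- boxs n J) f p = \sum_(p <- boxs n J) g p.
Proof.
move=> fg; rewrite big_seq [RHS]big_seq; apply: eq_bigr => p.
by rewrite mem_boxs => /andP[]; exact: fg.
Qed.

Lemma sum_boxs_ge0 (R : realType) (n J : nat) (f : idx n -> R) :
  (forall p, idx_pos p -> 0 <= f p) -> 0 <= \sum_(p <- boxs n J) f p.
Proof.
move=> f0; rewrite big_seq; apply: sumr_ge0 => p.
by rewrite mem_boxs => /andP[] /f0.
Qed.

Lemma sum_boxs_leq (R : realType) (n J J' : nat) (f : idx n -> R) :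
  (J <= J')%N -> (forall p, idx_pos p -> 0 <= f p) ->
  \sum_(p <- boxs n J) f p <= \sum_(p <- boxs n J') f p.
Proof.
move=> JJ' f0.
have -> : \sum_(p <- boxs n J) f p = \sum_(p <- boxs n J) (p.2 <= J)%:R * f p.
  by apply: eq_sum_boxs => p _ ->; rewrite mul1r.
rewrite (@sum_boxs_enlarge _ _ J J' (fun p => (p.2 <= J)%N))//.
by apply: ler_sum_boxs => p p0 _; case: (p.2 <= J)%N; rewrite ?mul1r// mul0r f0.
Qed.

(** Summation by parts in each class: the departure terms become the weighted mass minus a term
    governed by the decrease of [w]. The boundary term carries the factor [w (i, J)]. *)
Lemma abel_boxs (R : realType) (n J : nat) (w x : idx n -> R) :
  (forall i, w (i, J) = 0) ->
  \sum_(p <- boxs n J) w p * (p.2%:R * (x p - x (p.1, p.2.+1))) =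
  \sum_(p <- boxs n J) w p * x p -
  \sum_(p <- boxs n J) p.2.-1%:R * (w (p.1, p.2.-1) - w p) * x p.
Proof.
move=> wJ; rewrite !big_boxs -sumrB; apply: eq_bigr => i _ /=.
have H K : \sum_(j < K) w (i, j.+1) * (j.+1%:R * (x (i, j.+1) - x (i, j.+2))) =
  \sum_(j < K) w (i, j.+1) * x (i, j.+1) -
  \sum_(j < K) j%:R * (w (i, nat_of_ord j) - w (i, j.+1)) * x (i, j.+1) -
  w (i, K) * K%:R * x (i, K.+1).
  elim: K => [|K ih]; first by rewrite !big_ord0 mulr0 mul0r !subr0.
  by rewrite !big_ord_recr /= ih -natr1; ring.
by rewrite H wJ !mul0r subr0.
Qed.

Section state.
Context {R : realType} {n : nat} (u : 'I_n.+1 -> R -> R) (lambda mu : R)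
  (alpha : 'I_n.+1 -> R).
Hypothesis u_concave : forall i, concave_on_nneg (u i).
Hypothesis mu_gt0 : 0 < mu.
Hypothesis alpha01 : forall i, 0 < alpha i < 1.

Lemma alpha_gt0 i : 0 < alpha i.
Proof. by case/andP: (alpha01 i). Qed.

Section point.
Variable x : idx n -> R.
Hypothesis Qx : Q alpha x.

Lemma Q_ge0 p : 0 <= x p.
Proof. by case: Qx => /(_ p) /andP[]. Qed.

Lemma Q_le1 p : x p <= 1.
Proof. by case: Qx => /(_ p) /andP[]. Qed.

Lemma Q0 i : x (i, 0%N) = alpha i.
Proof. by case: Qx => _ _ /(_ i 0%N) []. Qed.

Lemma Q_le_alpha p : x p <= alpha p.1.
Proof. by case: p => i j; case: Qx => _ _ /(_ i j) [_ + <-]. Qed.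

Lemma Q_succ i j : x (i, j.+1) <= x (i, j).
Proof. by case: Qx => _ _ /(_ i j) []. Qed.

Lemma Q_anti i j k : (j <= k)%N -> x (i, k) <= x (i, j).
Proof.
elim: k => [|k ih]; first by rewrite leqn0 => /eqP ->.
rewrite leq_eqVlt => /orP[/eqP -> //|/ih]; exact/le_trans/Q_succ.
Qed.

Lemma Q_boxs_le J : \sum_(p <- boxs n J) x p <= fine (l1norm x).
Proof.
have [_ xfin _] := Qx.
have l0 : (0 <= l1norm x)%E by apply: esum_ge0 => p _; rewrite lee_fin.
rewrite -lee_fin fineK ?ge0_fin_numE//.
apply: esum_ge; exists [set` boxs n J]; first by split=> //; exact: finite_seq.
rewrite -fsbig_seq ?boxs_uniq// sumEFin lee_fin.
by apply: ler_sum => p _; exact: ler_norm.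
Qed.

(** Otherwise class [i] alone would contribute at least [J%:R * alpha i] to the norm, for every
    [J]. *)
Lemma Q_lt_alpha i : exists j, x (i, j.+1) < alpha i.
Proof.
apply: contrapT => nex.
have ge j : alpha i <= x (i, j.+1).
  by rewrite leNgt; apply/negP => h; apply: nex; exists j.
pose K := fine (l1norm x).
have KJ J : J%:R * alpha i <= K.
  apply: le_trans (Q_boxs_le J); rewrite big_boxs (bigD1 i)//=.
  rewrite -[leLHS]addr0; apply: lerD.
    rewrite -[J in J%:R]card_ord mulr_natl -sumr_const.
    by apply: ler_sum => j _; exact: ge.
  by apply: sumr_ge0 => k _; apply: sumr_ge0 => j _; exact: Q_ge0.
have K0 : 0 <= K by have := KJ 0%N; rewrite mul0r.
have := KJ (Num.Def.truncn (K / alpha i)).+1.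
rewrite -ler_pdivlMr ?alpha_gt0// leNgt truncnS_gt//.
Qed.

Let s := sigma u x.

(** The set of strict drops is nonempty, since the first level at which a class falls below [alpha]
    is a drop; [tri_max] then provides its maximum. *)
Lemma sigmaP : [/\ idx_pos s, x s < x (s.1, s.2.-1) &
  forall p, idx_pos p -> x p < x (p.1, p.2.-1) -> p = s \/ tri u p s].
Proof.
pose D := [set p : idx n | idx_pos p /\ x (p.1, p.2.-1) > x p].
have D0 : D !=set0.
  have ex := Q_lt_alpha ord0; case: (ex_minnP ex) => m hm hmin.
  exists (ord0, m.+1); split=> //=; case: m hm hmin => [|m] hm hmin.
    by rewrite Q0.
  apply: (lt_le_trans hm); rewrite leNgt; apply/negP => /hmin.
  by rewrite ltnn.
have [t Dt ht] := @tri_max _ _ u u_concave D (fun p => @proj1 _ _) D0.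
rewrite /s /sigma -/D; case: xgetP => [z _ [[z0 zx] hz]|/(_ t)[]].
  by split=> // p p0 px; apply: hz.
by split.
Qed.

(** All lower positive levels of the class are also above [sigma], so none of them is a drop and the
    value [alpha] at level 0 propagates. *)
Lemma sigma_above p : idx_pos p -> tri u s p -> x p = alpha p.1.
Proof.
case: p => i [//|j] _; have [_ _ hs] := sigmaP.
have eq_pred k : tri u s (i, k.+1) -> x (i, k.+1) = x (i, k).
  move=> h; apply/eqP; rewrite eq_le Q_succ leNgt; apply/negP => lt.
  have [//|e|/(tri_trans h)] := hs (i, k.+1) _ lt; last by rewrite tri_irr.
  by move: h; rewrite e tri_irr.
elim: j => [|j ih] h; rewrite eq_pred ?Q0// ih//.
exact: (tri_trans h (tri_succ u_concave i j)).
Qed.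

Lemma sigma_above_bounded :
  exists J, forall p, idx_pos p -> (p == s) || tri u s p -> (p.2 <= J)%N.
Proof.
have [jf hj] := choice Q_lt_alpha.
exists (maxn s.2 (\max_i jf i)%N) => p p0 /orP[/eqP ->|ps].
  exact: leq_maxl.
apply: (leq_trans _ (leq_maxr _ _)); apply: leq_trans (leq_bigmax p.1).
rewrite leqNgt; apply/negP => h.
have := hj p.1; rewrite ltNge; apply/negP; rewrite negbK.
rewrite -(sigma_above p0 ps) [in x p](surjective_pairing p).
exact: Q_anti.
Qed.

Local Notation L := (Lambda u lambda mu alpha x).

(** The rate at [sigma] is by definition [lambda] minus the rates above it, and the rates below it
    vanish. *)
Lemma sum_Lambda J :
  (forall p, idx_pos p -> (p == s) || tri u s p -> (p.2 <= J)%N) ->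
  \sum_(p <- boxs n J) L p = lambda.
Proof.
move=> hJ; have [s0 _ _] := sigmaP.
pose g (p : idx n) := mu * p.2%:R * (alpha p.1 - x (p.1, p.2.+1)).
pose c := lambda - \sum_(p \in above u s) g p.
transitivity (\sum_(p <- boxs n J) ((tri u s p)%:R * g p + (p == s)%:R * c)).
  apply: eq_bigr => p _; rewrite /Lambda -/s.
  case: ifPn => [h|_]; last first.
    by rewrite mul0r add0r; case: eqP; rewrite ?mul1r ?mul0r.
  rewrite mul1r; case: eqP => [e|_]; last by rewrite mul0r addr0.
  by move: h; rewrite e tri_irr.
rewrite big_split /= -sum_boxs_fsbig; last first.
  by move=> p p0 h; apply: hJ => //; rewrite h orbT.
rewrite sum_boxs_pred1 ?hJ ?eqxx// ?andbT//.
by rewrite /c /above subrKC.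
Qed.

Lemma sum_upset_Lambda J (A : pred (idx n)) :
  (forall p q, idx_pos p -> idx_pos q -> A p -> tri u p q -> A q) ->
  (forall p, idx_pos p -> A p -> (p.2 <= J)%N) -> A s ->
  \sum_(p <- boxs n J) (A p)%:R * L p = lambda.
Proof.
move=> Aup AJ As; have [s0 _ _] := sigmaP.
have sA p : idx_pos p -> (p == s) || tri u s p -> A p.
  by move=> p0 /orP[/eqP ->//|]; exact: Aup.
rewrite -[RHS](@sum_Lambda J); last by move=> p p0 /(sA p p0) /(AJ p p0).
apply: eq_sum_boxs => p p0 _.
have [_|nAp] := boolP (A p); first by rewrite mul1r.
have := contra (sA p p0) nAp; rewrite negb_or => /andP[ps sp].
by rewrite /Lambda -/s (negbTE ps) (negbTE sp) mulr0.
Qed.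

(** The right-hand side of the fluid equation, as a function of a single state. *)
Definition drift (p : idx n) : R := L p - mu * p.2%:R * (x p - x (p.1, p.2.+1)).

Hypothesis L_ge0 : forall p, idx_pos p -> 0 <= L p.

Lemma sum_weighted_Lambda_le J (w : idx n -> R) :
  (forall p, 0 <= w p <= 1) -> \sum_(p <- boxs n J) w p * L p <= lambda.
Proof.
move=> w01; have [J' hJ'] := sigma_above_bounded.
rewrite -[leRHS](@sum_Lambda (maxn J J')); last first.
  by move=> p p0 /(hJ' _ p0) h; rewrite leq_max h orbT.
apply: le_trans (sum_boxs_leq (leq_maxl J J') L_ge0).
apply: ler_sum_boxs => p p0 _; case/andP: (w01 p) => w0 w1.
by rewrite /= ler_piMl// L_ge0.
Qed.

Lemma sum_drift_le J : \sum_(p <- boxs n J) drift p <= lambda.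
Proof.
have := @sum_weighted_Lambda_le J (fun=> 1).
rewrite ler01 lexx => /(_ _)/wrap[//|].
apply: le_trans; apply: ler_sum => p _; rewrite mul1r /drift gerBl.
by rewrite !mulr_ge0 ?(ltW mu_gt0)// subr_ge0; case: p => i j; exact: Q_succ.
Qed.

Lemma sum_weighted_drift J (w : idx n -> R) :
  (forall i, w (i, J) = 0) ->
  \sum_(p <- boxs n J) w p * drift p =
  \sum_(p <- boxs n J) w p * L p - mu * (\sum_(p <- boxs n J) w p * x p
  - \sum_(p <- boxs n J) p.2.-1%:R * (w (p.1, p.2.-1) - w p) * x p).
Proof.
move=> wJ; rewrite -abel_boxs// mulr_sumr -sumrB; apply: eq_bigr => p _.
by rewrite /drift; ring.
Qed.

(** A truncated form of the equation for the total mass, in the shape that [ac_gronwall] expects.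
    The slowly decreasing weights turn the boundary loss into an error of at most [mu * e * K]. *)
Lemma weighted_drift_le J (w : idx n -> R) (e K : R) :
  0 <= e -> (forall i, w (i, J) = 0) -> (forall p, 0 <= w p <= 1) ->
  (forall p, idx_pos p -> p.2.-1%:R * (w (p.1, p.2.-1) - w p) <= e) ->
  \sum_(p <- boxs n J) x p <= K ->
  \sum_(p <- boxs n J) w p * drift p <=
  mu * (lambda / mu + e * K - \sum_(p <- boxs n J) w p * x p).
Proof.
move=> e0 wJ w01 we xK; rewrite sum_weighted_drift//.
have h1 := sum_weighted_Lambda_le J w01.
have h2 :
    \sum_(p <- boxs n J) p.2.-1%:R * (w (p.1, p.2.-1) - w p) * x p <= e * K.
  apply: (@le_trans _ _ (\sum_(p <- boxs n J) e * x p)).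
    by apply: ler_sum_boxs => p p0 _; rewrite ler_wpM2r ?Q_ge0 ?we.
  by rewrite -mulr_sumr ler_wpM2l.
have h3 := ler_wpM2l (ltW mu_gt0) h2.
have h4 : mu * (lambda / mu) = lambda by rewrite mulrC divfK// gt_eqF.
by rewrite !mulrBr mulrDr h4; lra.
Qed.

(** If [sigma] is in [A], the rates over [A] sum to [lambda], and the correction from summation by
    parts has a favourable sign because the indicator of [A] is nonincreasing in the level.
    Otherwise all of [A] lies above [sigma], where [x] equals [alpha] and arrivals balance
    departures. The strict bound by [J] makes the indicator vanish at level [J]. *)
Lemma upset_drift J (A : pred (idx n)) :
  (0 < J)%N ->
  (forall p q, idx_pos p -> idx_pos q -> A p -> tri u p q -> A q) ->
  (forall p, idx_pos p -> A p -> (p.2 < J)%N) ->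
  (A s -> lambda - mu * \sum_(p <- boxs n J) (A p)%:R * x p <=
    \sum_(p <- boxs n J) (A p)%:R * drift p) /\
  (~~ A s -> \sum_(p <- boxs n J) (A p)%:R * drift p = 0 /\
    \sum_(p <- boxs n J) (A p)%:R * x p =
    \sum_(p <- boxs n J) (A p)%:R * alpha p.1).
Proof.
move=> J0 Aup AJ; have [s0 _ _] := sigmaP; split=> As.
  rewrite sum_weighted_drift; last first.
    move=> i; apply/eqP; rewrite pnatr_eq0 eqb0.
    by apply/negP => /AJ; rewrite ltnn => /(_ J0).
  rewrite (sum_upset_Lambda Aup _ As); last by move=> p p0 /(AJ p p0) /ltnW.
  rewrite lerB// ler_wpM2l ?(ltW mu_gt0)// gerBl.
  apply: sum_boxs_ge0 => -[i [//|[|j]]] _ /=; first by rewrite !mul0r.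
  rewrite mulr_ge0 ?Q_ge0// mulr_ge0// subr_ge0 ler_nat.
  have := Aup (i, j.+2) (i, j.+1) isT isT.
  by case: (A (i, j.+2)) => // /(_ isT (tri_succ u_concave i j)) ->.
have As' p : idx_pos p -> A p -> tri u s p.
  move=> p0 Ap; apply/negPn/negP.
  rewrite triN => /orP[/eqP e|/(Aup _ _ p0 s0 Ap)].
    by move: As; rewrite -e Ap.
  by rewrite (negbTE As).
split.
  rewrite (eq_sum_boxs (g := fun=> 0)) ?big1// => p p0 _.
  have [Ap|] := boolP (A p); last by rewrite mul0r.
  rewrite /drift /Lambda -/s (As' p p0 Ap) (sigma_above p0 (As' p p0 Ap)).
  by rewrite subrr mulr0.
apply: eq_sum_boxs => p p0 _; have [Ap|] := boolP (A p); last by rewrite !mul0r.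
by rewrite (sigma_above p0 (As' p p0 Ap)).
Qed.

End point.
End state.

(** * The equilibrium *)

(** Take [w j] to be the positive part of [1 - e * H j.-1], with [H] the partial harmonic sums.
    Divergence of [H] gives finite support, its increments give the third bound, and [H j <= j%:R]
    gives the last. *)
Lemma harmonic_weights (R : realType) (e : R) : 0 < e ->
  exists w : nat -> R, [/\ forall j, 0 <= w j <= 1,
    exists N, forall j, (N <= j)%N -> w j = 0,
    forall j, j%:R * (w j - w j.+1) <= e &
    forall j, 1 - e * j%:R <= w j.+1].
Proof.
move=> e0; pose H := series (@harmonic R).
have HS k : H k.+1 = H k + k.+1%:R^-1 by rewrite /H /series /= big_nat_recr.
have H0 : H 0%N = 0 by rewrite /H /series /= big_geq.
have Hge0 k : 0 <= H k by apply: sumr_ge0 => i _; exact: harmonic_ge0.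
have Hnd : {homo H : m k / (m <= k)%N >-> m <= k}.
  by apply/nondecreasing_seqP => k; rewrite HS lerDl invr_ge0.
have Hle k : H k <= k%:R.
  elim: k => [|k ih]; first by rewrite H0.
  by rewrite HS -[in leRHS]natr1 lerD// invf_le1// ler1n.
pose w j := Num.max 0 (1 - e * H j.-1).
exists w; split.
- move=> j; rewrite /w le_max lexx /= ge_max ler01 /= gerBl.
  by rewrite mulr_ge0// ltW.
- have [k hk] : exists k, e^-1 < H k.
    apply: contrapT => nex; apply: (@dvg_harmonic R).
    apply: nondecreasing_is_cvgn => //; exists e^-1 => _ [k _ <-].
    by rewrite leNgt; apply/negP => h; apply: nex; exists k.
  exists k.+1 => -[//|j] kj; rewrite /w max_l//= subr_le0.
  rewrite -ler_pdivrMl// mulr1.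
  by apply: le_trans (ltW hk) (Hnd _ _ _); rewrite -ltnS.
- case=> [|j]; first by rewrite mul0r ltW.
  rewrite /w /= HS.
  have maxB (a d : R) : 0 <= d ->
      Num.max 0 (1 - a) - Num.max 0 (1 - (a + d)) <= d.
    by move=> d0; rewrite /Num.max; case: ltP => ?; case: ltP => ?; lra.
  have : 0 <= e * j.+1%:R^-1 by rewrite mulr_ge0 ?invr_ge0// ltW.
  move=> /(maxB (e * H j)); rewrite -mulrDr.
  move=> h; have := ler_wpM2l (ler0n R j.+1) h.
  by rewrite mulrCA divff ?pnatr_eq0// mulr1.
- move=> j; rewrite /w le_max; apply/orP; right.
  by apply: lerB => //; apply: ler_wpM2l; [exact: ltW|exact: Hle].
Qed.

Lemma tri_min_seq (R : realType) (n : nat) (u : 'I_n.+1 -> R -> R)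
    (r : seq (idx n)) (p0 : idx n) : p0 \in r ->
  exists2 m, m \in r & forall p, p \in r -> (p == m) || tri u m p.
Proof.
elim: r p0 => // a r ih p0 _.
case: r ih => [_|b r ih].
  by exists a; rewrite ?mem_head// => p; rewrite inE => ->.
have [m mr hm] := ih b (mem_head _ _).
have [am|am] := boolP (tri u a m).
  exists a; rewrite ?mem_head// => p.
  rewrite inE => /orP[->//|/hm /orP[/eqP ->|]].
    by rewrite am orbT.
  by move=> /(tri_trans am) ->; rewrite orbT.
exists m; first by rewrite inE mr orbT.
move=> p; rewrite inE => /orP[/eqP ->|/hm//].
by move: am; rewrite triN eq_sym.
Qed.

Lemma sum_boxs_above_eq (R : realType) (n J : nat) (u : 'I_n.+1 -> R -> R)
    (s : idx n) (f : idx n -> R) : (0 < s.2 <= J)%N ->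
  \sum_(p <- boxs n J) ((p == s) || tri u s p)%:R * f p =
  \sum_(p <- boxs n J) (tri u s p)%:R * f p + f s.
Proof.
move=> sJ; rewrite -[X in _ = _ + X](sum_boxs_pred1 f sJ) -big_split.
apply: eq_bigr => p _ /=; rewrite -mulrDl; congr (_ * _).
by case: eqP => [->|]; rewrite ?tri_irr ?add0r ?addr0.
Qed.

(** Shifting the levels by one moves level 0 into the positive indices, where [esum_le_boxs]
    applies. *)
Lemma esum_le_rows (R : realType) (n : nat) (f : idx n -> R) (c : R) :
  (forall p, 0 <= f p) ->
  (forall J, \sum_(i < n.+1) f (i, 0%N) + \sum_(p <- boxs n J) f p <= c) ->
  (\esum_(p in [set: idx n]) (f p)%:E <= c%:E)%E.
Proof.
move=> f0 fc.
pose g (p : idx n) := f (p.1, p.2.-1).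
have -> : (\esum_(p in [set: idx n]) (f p)%:E =
           \esum_(p in [set p : idx n | idx_pos p /\ true]) (g p)%:E)%E.
  rewrite [RHS](@reindex_esum _ _ _ [set: idx n] _ (fun p => (p.1, p.2.+1))).
    by apply: eq_esum => -[].
  split; first by move=> p _.
    by move=> [i j] [i' j'] _ _ [-> ->].
  by move=> [i [[]//|j]] _; exists (i, j).
apply: (@esum_le_boxs _ _ predT) => [p|J]; first exact: f0.
under eq_bigr do rewrite mul1r.
apply: le_trans (fc J); rewrite !big_boxs -big_split; apply: ler_sum => i _ /=.
rewrite /g /=; case: J => [|J]; first by rewrite !big_ord0 addr0 f0.
by rewrite big_ord_recl big_ord_recr /= lerD2l lerDl f0.
Qed.

(** * The threshold index [sigma_star] and finite formulas for [q_star] *)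

Section star.
Context {R : realType} {n : nat} (u : 'I_n.+1 -> R -> R) (rho : R)
  (alpha : 'I_n.+1 -> R).
Hypothesis u_concave : forall i, concave_on_nneg (u i).
Hypothesis alpha01 : forall i, 0 < alpha i < 1.
Hypothesis rho_ge0 : 0 <= rho.

Let s := sigma_star u alpha rho.
Let A : pred (idx n) := tri u s.
Let B : pred (idx n) := fun p => (p == s) || tri u s p.

Lemma above_eqE t : above_eq u t = [set p | idx_pos p /\ (p == t) || tri u t p].
Proof. by apply/seteqP; split=> p /= [p0 h]; split=> //; exact/orP. Qed.

Lemma row_boxs_le (C : pred (idx n)) i J :
  (forall j, (0 < j <= J)%N -> C (i, j)) ->
  J%:R * alpha i <= \sum_(p <- boxs n J) (C p)%:R * alpha p.1.
Proof.
move=> CJ; rewrite big_boxs (bigD1 i)//= -[leLHS]addr0; apply: lerD.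
  rewrite -[J in J%:R]card_ord mulr_natl -sumr_const.
  by apply: ler_sum => j _; rewrite CJ ?mul1r//= ltn_ord.
apply: sumr_ge0 => k _; apply: sumr_ge0 => j _.
by rewrite mulr_ge0// ltW// (alpha_gt0 alpha01).
Qed.

Let alpha_ge0 (p : idx n) : 0 <= alpha p.1.
Proof. exact/ltW/alpha_gt0. Qed.

(** The witness is the largest [t] whose closed upper set has mass above [rho]. If the open upper
    set of [t] also had mass above [rho], so would its part in some box; the least element of that
    part would then be a larger candidate. *)
Lemma sigma_starP : [/\ idx_pos s,
    (\esum_(p in above u s) (alpha p.1)%:E <= rho%:E)%E &
    (rho%:E < \esum_(p in above_eq u s) (alpha p.1)%:E)%E].
Proof.
pose D := [set t : idx n | idx_pos t /\
  (rho%:E < \esum_(p in above_eq u t) (alpha p.1)%:E)%E].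
have D0 : D !=set0.
  (* Chosen so that [J%:R * alpha ord0] exceeds [rho]: the first [J] levels of one class suffice. *)
  pose J := (Num.truncn (rho / alpha ord0)).+1.
  exists (ord0, J); split=> //; rewrite above_eqE.
  apply: lt_le_trans (@boxs_le_esum _ _ J _ (fun p => alpha p.1) alpha_ge0).
  rewrite lte_fin; apply: (@lt_le_trans _ _ (J%:R * alpha ord0)).
    by rewrite -ltr_pdivrMr ?(alpha_gt0 alpha01)// truncnS_gt.
  apply: row_boxs_le => j /andP[j0]; rewrite leq_eqVlt => /orP[/eqP ->|jJ].
    by rewrite eqxx.
  by rewrite (tri_leq u_concave) ?orbT.
have [t [t0 Dt] ht] := @tri_max _ _ u u_concave D (fun p => @proj1 _ _) D0.
rewrite /s /sigma_star; case: xgetP => [//|/(_ t)[]]; split=> //.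
apply: (@esum_le_boxs _ _ (tri u t) (fun p => alpha p.1)) => // J.
rewrite leNgt; apply/negP => lt.
have [[p0 p0r]|nex] :=
    pselect (exists p0, p0 \in [seq p <- boxs n J | tri u t p]).
  have [m] := tri_min_seq u p0r.
  rewrite mem_filter mem_boxs => /and3P[tm m0 mJ] hm.
  suff /ht[e|mt] : D m.
  - by move: tm; rewrite e tri_irr.
  - by move: (tri_trans tm mt); rewrite tri_irr.
  split=> //; rewrite above_eqE.
  apply: lt_le_trans (@boxs_le_esum _ _ J _ (fun p => alpha p.1) alpha_ge0).
  rewrite lte_fin; apply: (lt_le_trans lt); apply: ler_sum_boxs => p p0' pJ.
  rewrite ler_wpM2r ?alpha_ge0//; have [tp|] := boolP (tri u t p); last by [].
  by rewrite hm// mem_filter tp mem_boxs p0'.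
move: lt; apply/negP; rewrite -leNgt; apply: le_trans rho_ge0.
rewrite (eq_sum_boxs (g := fun=> 0)) ?big1// => p p0 pJ.
case: (boolP (tri u t p)) => [tp|]; last by rewrite mul0r.
by exfalso; apply: nex; exists p; rewrite mem_filter tp mem_boxs p0.
Qed.

(** An index (i, j) above [sigma_star] brings along all (i, k) with 1 <= k <= j, so that
    [j%:R * alpha i <= rho]. *)
Lemma sigma_star_bounded :
  exists2 J, (0 < J)%N & forall p, idx_pos p -> B p -> (p.2 < J)%N.
Proof.
have [s0 sle _] := sigma_starP.
pose f i := (Num.truncn (rho / alpha i)).+1.
exists (maxn s.2 (\max_i f i)).+1 => // p p0; rewrite ltnS => /orP[/eqP ->|sp].
  exact: leq_maxl.
apply: (leq_trans _ (leq_maxr _ _)); apply: leq_trans (leq_bigmax p.1).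
rewrite leqNgt; apply/negP => lt.
have : p.2%:R * alpha p.1 <= rho.
  rewrite -lee_fin; apply: le_trans sle.
  apply: le_trans
    (@boxs_le_esum _ _ p.2 (tri u s) (fun p => alpha p.1) alpha_ge0).
  rewrite lee_fin; apply: row_boxs_le => j /andP[j0].
  rewrite leq_eqVlt => /orP[/eqP ->|jJ]; first by rewrite -surjective_pairing.
  apply: (tri_trans sp).
  by rewrite [X in tri _ X _](surjective_pairing p) tri_leq.
rewrite -ler_pdivlMr ?(alpha_gt0 alpha01)//; apply/negP; rewrite -ltNge.
by apply: (lt_le_trans (truncnS_gt _)); rewrite ler_nat ltnW.
Qed.

(** Replaces the possibly infinite sums in the definitions by one box sum [aA], at a level [J]
    suited to [upset_drift]. *)
Lemma q_star_spec : exists J aA, [/\ (0 < J)%N,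
  forall p, idx_pos p -> B p -> (p.2 < J)%N,
  aA = \sum_(p <- boxs n J) (A p)%:R * alpha p.1,
  aA <= rho < aA + alpha s.1 &
  forall p, q_star u alpha rho p = if p.2 == 0%N then alpha p.1
    else if A p then alpha p.1 else if p == s then rho - aA else 0].
Proof.
have [J J0 hJ] := sigma_star_bounded.
have [s0 sle slt] := sigma_starP.
have AJ p : idx_pos p -> A p -> (p.2 <= J)%N.
  by move=> p0 Ap; apply/ltnW/hJ => //; rewrite /B -/(A p) Ap orbT.
have BJ p : idx_pos p -> B p -> (p.2 <= J)%N by move=> p0 /(hJ p p0)/ltnW.
exists J, (\sum_(p <- boxs n J) (A p)%:R * alpha p.1); split=> //; last first.
  by move=> p; rewrite /q_star -/s (sum_boxs_fsbig _ AJ).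
apply/andP; split.
  rewrite -lee_fin; apply: le_trans sle.
  exact: (@boxs_le_esum _ _ J (tri u s) (fun p => alpha p.1) alpha_ge0).
rewrite -lte_fin; apply: (lt_le_trans slt); rewrite above_eqE.
apply: (@esum_le_boxs _ _ B (fun p => alpha p.1)) => // J'.
apply: (@le_trans _ _ (\sum_(p <- boxs n J) (B p)%:R * alpha p.1)).
  rewrite (sum_boxs_enlarge (J' := maxn J J') _ _ BJ) ?leq_maxl//.
  by apply: sum_boxs_leq; rewrite ?leq_maxr// => p _; rewrite mulr_ge0.
by rewrite (sum_boxs_above_eq u (fun p => alpha p.1)) ?BJ ?andbT /B ?eqxx.
Qed.

End star.

(** * Verification that [q_star] is an equilibrium *)

Section equilibrium.
Context {R : realType} {n : nat} (u : 'I_n.+1 -> R -> R) (lambda mu : R)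
  (alpha : 'I_n.+1 -> R).
Hypothesis u_concave : forall i, concave_on_nneg (u i).
Hypothesis lambda_gt0 : 0 < lambda.
Hypothesis mu_gt0 : 0 < mu.
Hypothesis alpha01 : forall i, 0 < alpha i < 1.

Let rho := lambda / mu.
Let qs := q_star u alpha rho.
Let s := sigma_star u alpha rho.
Let A : pred (idx n) := tri u s.
Let B : pred (idx n) := fun p => (p == s) || tri u s p.

Lemma rho_ge0 : 0 <= rho.
Proof. by rewrite divr_ge0 ?ltW. Qed.

Let s_pos : idx_pos s.
Proof. by have [] := sigma_starP u_concave alpha01 rho_ge0. Qed.

Let qs_spec := q_star_spec u_concave alpha01 rho_ge0.

Let alpha_ge0 i : 0 <= alpha i.
Proof. exact/ltW/alpha_gt0. Qed.

Lemma q_star_above p : idx_pos p -> tri u s p -> qs p = alpha p.1.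
Proof.
have [J [aA [_ _ _ _ qsE]]] := qs_spec.
by move=> p0 Ap; rewrite /qs qsE Ap if_same.
Qed.

Lemma q_star_below p : idx_pos p -> ~~ B p -> qs p = 0.
Proof.
have [J [aA [_ _ _ _ qsE]]] := qs_spec.
rewrite /idx_pos /= lt0n /qs => p0.
rewrite negb_or qsE (negbTE p0) => /andP[ps sp].
by rewrite -/s (negbTE ps) (negbTE sp).
Qed.

Lemma q_star0 i : qs (i, 0%N) = alpha i.
Proof. by have [J [aA [_ _ _ _ qsE]]] := qs_spec; rewrite /qs qsE. Qed.

Lemma q_star_bounds p : 0 <= qs p <= alpha p.1.
Proof.
have [J [aA [_ _ _ /andP[aA1 aA2] qsE]]] := qs_spec.
rewrite /qs qsE; case: ifP => _; first by rewrite alpha_ge0 lexx.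
case: ifP => _; first by rewrite alpha_ge0 lexx.
case: ifP => [/eqP ->|_]; last by rewrite alpha_ge0 lexx.
by rewrite -/s; apply/andP; split; lra.
Qed.

Lemma q_star_sigma_lt : qs s < alpha s.1.
Proof.
have [J [aA [_ _ _ /andP[aA1 aA2] qsE]]] := qs_spec.
move: s_pos; rewrite /idx_pos /= lt0n => /negbTE s0.
by rewrite /qs qsE -/s s0 /A tri_irr eqxx; lra.
Qed.

Lemma B_upset p q : idx_pos p -> idx_pos q -> B p -> tri u p q -> B q.
Proof.
move=> _ _ /orP[/eqP ->|sp] pq; first by rewrite /B pq orbT.
by rewrite /B (tri_trans sp pq) orbT.
Qed.

Lemma q_star_Q : Q alpha qs.
Proof.
have [J [aA [_ BJ aAE /andP[aA1 aA2] qsE]]] := qs_spec.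
split.
- move=> p; have /andP[-> h] := q_star_bounds p; apply: (le_trans h).
  by apply/ltW; have /andP[] := alpha01 p.1.
- pose c := \sum_(i < n.+1) alpha i + \sum_(p <- boxs n J) (B p)%:R * alpha p.1.
  apply: (@le_lt_trans _ _ c%:E); last exact: ltry.
  have n0 p : `|qs p| = qs p.
    by rewrite ger0_norm//; case/andP: (q_star_bounds p).
  rewrite /l1norm; under eq_esum do rewrite n0.
  apply: esum_le_rows => [p|J']; first by case/andP: (q_star_bounds p).
  rewrite /c (eq_bigr alpha) => [|i _]; last exact: q_star0.
  rewrite lerD2l.
  apply: (@le_trans _ _ (\sum_(p <- boxs n J') (B p)%:R * alpha p.1)).
    apply: ler_sum_boxs => p p0 _; have [Bp|nBp] := boolP (B p).
      by rewrite mul1r; case/andP: (q_star_bounds p).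
    by rewrite q_star_below// mul0r.
  rewrite (sum_boxs_enlarge _ (leq_maxl J J')
    (fun p p0 Bp => ltnW (BJ p p0 Bp))).
  by apply: sum_boxs_leq => [|p _]; rewrite ?leq_maxr// mulr_ge0.
- move=> i j; rewrite q_star0; split=> //; last first.
    by case/andP: (q_star_bounds (i, j)).
  case: j => [|j].
    by rewrite q_star0; case/andP: (q_star_bounds (i, 1%N)).
  have up := tri_succ u_concave i j.
  have [Bp|nBp] := boolP (B (i, j.+2)); last first.
    by rewrite q_star_below//; case/andP: (q_star_bounds (i, j.+1)).
  have sp : tri u s (i, j.+1).
    by case/orP: Bp => [/eqP <-//|sp]; exact: tri_trans sp up.
  by rewrite (@q_star_above (i, j.+1))//; case/andP: (q_star_bounds (i, j.+2)).
Qed.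

(** There is a drop at [s], where the value is below [alpha] while the preceding level carries
    [alpha]. There is no drop above [s], since [q_star] takes its maximal value there. *)
Lemma sigma_q_star : sigma u qs = s.
Proof.
have [t0 tlt tmax] := sigmaP u_concave alpha01 q_star_Q.
have [|//|h] := tmax s s_pos.
  apply: (lt_le_trans q_star_sigma_lt).
  move: s_pos; rewrite /idx_pos /=.
  case E: s.2 => [//|[|j]] _; first by rewrite q_star0.
  rewrite q_star_above//= [X in tri _ X _](surjective_pairing s) E.
  exact: tri_succ.
move: tlt; rewrite q_star_above//; apply: contraTeq => _; rewrite -leNgt.
by case/andP: (q_star_bounds ((sigma u qs).1, (sigma u qs).2.-1)).
Qed.

Lemma drift_q_star p : idx_pos p ->
  drift u lambda mu alpha qs p = 0 /\ 0 <= Lambda u lambda mu alpha qs p.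
Proof.
have [J [aA [J0 BJ aAE /andP[aA1 aA2] qsE]]] := qs_spec.
have BJ' q : idx_pos q -> B q -> (q.2 <= J)%N by move=> q0 /(BJ q q0)/ltnW.
have above q : idx_pos q -> tri u s q -> drift u lambda mu alpha qs q = 0.
  move=> q0 sq; rewrite /drift /Lambda sigma_q_star sq (q_star_above q0 sq).
  by rewrite subrr.
have below q : idx_pos q -> ~~ B q -> Lambda u lambda mu alpha qs q = 0.
  move=> q0; rewrite negb_or => /andP[/negbTE qs_ /negbTE sq].
  by rewrite /Lambda sigma_q_star sq qs_.
have succ q : idx_pos q -> B (q.1, q.2.+1) -> B q.
  case: q => i [//|j] _ /= h.
  exact: (B_upset (p := (i, j.+2)) _ _ h (tri_succ u_concave i j)).
(* The other indices of [B] have zero drift, so the drift at [s] is the sum over [B], which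
   summation by parts evaluates to [lambda - mu * rho]. The correction term vanishes because [qs] is
   zero off [B]. *)
have ats : drift u lambda mu alpha qs s = 0.
  transitivity (\sum_(p <- boxs n J) (B p)%:R * drift u lambda mu alpha qs p).
    rewrite (eq_sum_boxs
      (g := fun p => (p == s)%:R * drift u lambda mu alpha qs p)).
      by rewrite sum_boxs_pred1// BJ' ?andbT// /B eqxx.
    move=> q q0 _; rewrite /B; case: eqP => //= _.
    by case: (boolP (tri u s q)) => // /(above q q0) ->; rewrite mulr0 mul0r.
  rewrite sum_weighted_drift; last first.
    move=> i; apply/eqP; rewrite pnatr_eq0 eqb0.
    by apply/negP => /BJ; rewrite ltnn => /(_ J0).
  rewrite (sum_upset_Lambda _ _ u_concave alpha01 q_star_Q B_upset BJ')//;
    last by rewrite sigma_q_star /B eqxx.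
  have -> : \sum_(p <- boxs n J) (B p)%:R * qs p = rho.
    rewrite sum_boxs_above_eq; last by rewrite BJ' ?andbT// /B eqxx.
    rewrite (eq_sum_boxs (g := fun p => (A p)%:R * alpha p.1)) -?aAE; last first.
      move=> q q0 _; rewrite /A; case: (boolP (tri u s q)) => [sq|].
        by rewrite q_star_above.
      by rewrite !mul0r.
    rewrite /qs qsE -/s /A tri_irr eqxx.
    by move: s_pos; rewrite /idx_pos /= lt0n => /negbTE ->; rewrite subrKC.
  rewrite (eq_sum_boxs (g := fun=> 0)) ?big1 ?subr0.
  - by rewrite /rho mulrC divfK ?subrr// gt_eqF.
  - by [].
  - move=> [i [//|[|j]]] _ _ /=; first by rewrite !mul0r.
    have [Bq|nBq] := boolP (B (i, j.+2)); last by rewrite q_star_below// mulr0.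
    by rewrite (succ (i, j.+1))// subrr mulr0 mul0r.
move=> p0; have dr : drift u lambda mu alpha qs p = 0.
  have [Bp|nBp] := boolP (B p).
    by case/orP: Bp => [/eqP ->//|]; exact: above.
  rewrite /drift below// q_star_below// (@q_star_below (_, _))//.
    by rewrite subrr mulr0 subr0.
  by apply: contra nBp; exact: succ.
(* Zero drift identifies [Lambda] with the departure rate, which is nonnegative by monotonicity in
   the level. *)
split=> //; move/eqP: dr; rewrite /drift subr_eq0 => /eqP ->.
rewrite !mulr_ge0 ?(ltW mu_gt0)// subr_ge0.
by case: p {p0} => i j; exact: (Q_succ q_star_Q).
Qed.

Lemma equilibrium_q_star : equilibrium u lambda mu alpha qs.
Proof.
split; first exact: q_star_Q.
split=> [t _|p a b _ _|]; [exact: q_star_Q|exact: ac_cst|].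
apply: aeW => t _ p p0; have [dr L0] := drift_q_star p0; split=> //.
by move: dr; rewrite /drift => ->; exact: is_derive_cst.
Qed.

End equilibrium.

(** * Fluid trajectories *)

Section trajectory.
Context {R : realType} {n : nat} (u : 'I_n.+1 -> R -> R) (lambda mu : R)
  (alpha : 'I_n.+1 -> R).
Hypothesis u_concave : forall i, concave_on_nneg (u i).
Hypothesis lambda_gt0 : 0 < lambda.
Hypothesis mu_gt0 : 0 < mu.
Hypothesis alpha01 : forall i, 0 < alpha i < 1.
Variable q : R -> idx n -> R.
Hypothesis fluid_q : fluid_trajectory u lambda mu alpha q.

Let rho := lambda / mu.
Let L x := Lambda u lambda mu alpha x.

Lemma fluid_Q t : 0 <= t -> Q alpha (q t).
Proof. by have [+ _ _] := fluid_q; apply. Qed.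

Lemma fluid_sum_ac (w : idx n -> R) J a b : 0 <= a -> a <= b ->
  abs_continuous (fun t => \sum_(p <- boxs n J) w p * q t p) a b.
Proof.
move=> a0 ab; have [_ acq _] := fluid_q.
by apply: ac_sum => p; apply: acZ; exact: acq.
Qed.

Lemma fluid_sum_ae (w : idx n -> R) J a b (g : R -> R) : 0 <= a ->
  (forall t, a <= t <= b -> (forall p, idx_pos p -> 0 <= L (q t) p) ->
     \sum_(p <- boxs n J) w p * drift u lambda mu alpha (q t) p <= g t) ->
  {ae (@lebesgue_measure R), forall t, a <= t <= b ->
    exists2 d, is_derive t (1 : R) (fun t => \sum_(p <- boxs n J) w p * q t p) d
      & d <= g t}.
Proof.
move=> a0 dg; have [_ _ [N [mN N0 hN]]] := fluid_q.
exists N; split=> //; apply: subset_trans hN; apply: subsetC => t /= h atb.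
have t0 : 0 <= t by case/andP: atb => [/(le_trans a0)].
exists (\sum_(p <- boxs n J) w p * drift u lambda mu alpha (q t) p).
  apply: is_derive_sum_seq => p; rewrite mem_boxs => /andP[p0 _].
  by have [dq _] := h t0 p p0; exact: is_deriveZ.
by apply: dg => // p p0; have [] := h t0 p p0.
Qed.

Lemma fluid_gronwall (w : idx n -> R) J a b c : 0 <= a -> a <= b ->
  (forall t, a <= t <= b -> (forall p, idx_pos p -> 0 <= L (q t) p) ->
     \sum_(p <- boxs n J) w p * drift u lambda mu alpha (q t) p <=
     mu * (c - \sum_(p <- boxs n J) w p * q t p)) ->
  \sum_(p <- boxs n J) w p * q b p <=
  c + (\sum_(p <- boxs n J) w p * q a p - c) * expR (- (mu * (b - a))).
Proof.
move=> a0 ab /(fluid_sum_ae a0).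
apply: (ac_gronwall (M := \sum_(p <- boxs n J) `|w p|) (ltW mu_gt0) ab).
  exact: fluid_sum_ac.
move=> t /andP[at_ _]; apply: (le_trans (ler_norm_sum _ _ _)).
apply: ler_sum => p _; have Qt := fluid_Q (le_trans a0 at_).
by rewrite normrM ler_piMr// ger0_norm ?(Q_ge0 Qt)// (Q_le1 Qt).
Qed.

Let K0 := fine (l1norm (q 0)).

(** A crude bound, uniform in [J]; it supplies the constant [K] of [weighted_drift_le] on a bounded
    time interval. *)
Lemma fluid_mass_linear_growth J t : 0 <= t ->
  \sum_(p <- boxs n J) q t p <= K0 + lambda * t.
Proof.
move=> t0; have h : forall s, 0 <= s <= t ->
    (forall p, idx_pos p -> 0 <= L (q s) p) ->
    \sum_(p <- boxs n J) 1 * drift u lambda mu alpha (q s) p <= lambda.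
  move=> s /andP[s0 _] L0; under eq_bigr do rewrite mul1r.
  exact: (sum_drift_le u_concave mu_gt0 alpha01 (fluid_Q s0)).
have := ac_linear_growth t0 (fluid_sum_ac (fun=> 1) J (lexx 0) t0)
  (fluid_sum_ae (lexx 0) h).
rewrite subr0 /=.
have sum1 r : \sum_(p <- boxs n J) 1 * q r p = \sum_(p <- boxs n J) q r p.
  by apply: eq_bigr => p _; rewrite mul1r.
rewrite !sum1 => /le_trans; apply; rewrite lerD2r.
by apply: Q_boxs_le; exact: fluid_Q.
Qed.

Lemma fluid_mass_le J t : 0 <= t ->
  \sum_(p <- boxs n J) q t p <= rho + K0 * expR (- (mu * t)).
Proof.
move=> t0; pose KT := K0 + lambda * t.
have massT J' s : 0 <= s <= t -> \sum_(p <- boxs n J') q s p <= KT.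
  move=> /andP[s0 st]; apply: (le_trans (fluid_mass_linear_growth J' s0)).
  by rewrite lerD2l ler_wpM2l// ltW.
have KT0 : 0 <= KT.
  apply: le_trans (massT 0%N t _); last by rewrite t0 lexx.
  by apply: sum_boxs_ge0 => p _; exact: (Q_ge0 (fluid_Q t0)).
have rho0 : 0 <= rho by rewrite divr_ge0 ?ltW.
apply/ler_addgt0Pr => e' e'0.
(* Two errors must fit in [e']: [e * KT] from the weighted equation, and [e * J%:R * KT] from
   replacing the weights by 1 on the box of level [J]. *)
pose e := e' / (KT * (1 + J%:R) + 1).
have D0 : 0 < KT * (1 + J%:R) + 1 by rewrite ltr_wpDl// mulr_ge0// addr_ge0.
have e0 : 0 < e by rewrite divr_gt0.
have [w [w01 [N wN] we wge]] := harmonic_weights e0.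
pose v (p : idx n) := w p.2.
(* At least [N], so that the weights vanish at level [M]; at least [J], so that the larger box
   contains the one of interest. *)
pose M := maxn N J.
have := @fluid_gronwall v M 0 t (rho + e * KT) (lexx 0) t0.
move=> /(_ _)/wrap[s /andP[s0 st] L0|].
  apply: (weighted_drift_le u_concave mu_gt0 alpha01 (fluid_Q s0) L0) => //.
  - exact: ltW.
  - by move=> i; rewrite /v wN// leq_maxl.
  - by move=> p; exact: w01.
  - by move=> [i [//|j]] _; exact: we.
  - by apply: massT; rewrite s0.
rewrite subr0 => h.
have h0 : \sum_(p <- boxs n M) v p * q 0 p <= K0.
  apply: le_trans (Q_boxs_le (fluid_Q (lexx 0)) M).
  apply: ler_sum => p _; rewrite ler_piMl ?(Q_ge0 (fluid_Q (lexx 0)))//.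
  by case/andP: (w01 p.2).
have h1 : \sum_(p <- boxs n J) q t p - e * J%:R * KT <=
    \sum_(p <- boxs n M) v p * q t p.
  have vq0 p : idx_pos p -> 0 <= v p * q t p.
    by rewrite mulr_ge0 ?(Q_ge0 (fluid_Q t0))//; case/andP: (w01 p.2).
  apply: le_trans (sum_boxs_leq (leq_maxr N J) vq0).
  apply: (@le_trans _ _ (\sum_(p <- boxs n J) (1 - e * J%:R) * q t p)).
    rewrite -mulr_sumr mulrBl mul1r lerB// ler_wpM2l ?massT ?t0 ?lexx//.
    by rewrite mulr_ge0 ?(ltW e0).
  apply: ler_sum_boxs => -[i [//|j]] _ /= jJ.
  rewrite ler_wpM2r ?(Q_ge0 (fluid_Q t0))//; apply: le_trans (wge j).
  by rewrite lerB// ler_wpM2l ?(ltW e0)// ler_nat ltnW.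
have h2 : e * (KT * (1 + J%:R)) <= e'.
  rewrite /e mulrAC ler_pdivrMr// ler_wpM2l ?(ltW e'0)// lerDl//.
have E0 : 0 <= expR (- (mu * t)) by exact: expR_ge0.
have h3 := ler_wpM2r E0 h0.
have h4 : 0 <= (rho + e * KT) * expR (- (mu * t)).
  by rewrite mulr_ge0// addr_ge0// mulr_ge0// ltW.
lra.
Qed.

End trajectory.

(** * Exponential convergence to [q_star] *)

Section convergence.
Context {R : realType} {n : nat} (u : 'I_n.+1 -> R -> R) (lambda mu : R)
  (alpha : 'I_n.+1 -> R).
Hypothesis u_concave : forall i, concave_on_nneg (u i).
Hypothesis lambda_gt0 : 0 < lambda.
Hypothesis mu_gt0 : 0 < mu.
Hypothesis alpha01 : forall i, 0 < alpha i < 1.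

Let rho := lambda / mu.
Let qs := q_star u alpha rho.

Section trajectory.
Variable q : R -> idx n -> R.
Hypothesis fluid_q : fluid_trajectory u lambda mu alpha q.

Let lambdaE : lambda = mu * rho.
Proof. by rewrite /rho mulrC divfK// gt_eqF. Qed.

Let sumN J (C : pred (idx n)) (f : idx n -> R) :
  \sum_(p <- boxs n J) - (C p)%:R * f p = - \sum_(p <- boxs n J) (C p)%:R * f p.
Proof. by rewrite -sumrN; apply: eq_bigr => p _; rewrite mulNr. Qed.

(** Gronwall for minus the mass of [A], with target [- aA]. While [sigma] is in [A], use
    [aA <= rho]; otherwise [A] is full and both sides of the differential inequality are zero. *)
Lemma fluid_fill (A : pred (idx n)) J t :
  (0 < J)%N ->
  (forall p r, idx_pos p -> idx_pos r -> A p -> tri u p r -> A r) ->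
  (forall p, idx_pos p -> A p -> (p.2 < J)%N) ->
  let aA := \sum_(p <- boxs n J) (A p)%:R * alpha p.1 in
  aA <= rho -> 0 <= t ->
  aA - \sum_(p <- boxs n J) (A p)%:R * q t p <= aA * expR (- (mu * t)).
Proof.
move=> J0 Aup AJ aA arho t0.
have := @fluid_gronwall _ _ u lambda mu alpha mu_gt0 q fluid_q
  (fun p => - (A p)%:R) J 0 t (- aA) (lexx 0) t0.
move=> /(_ _)/wrap[r /andP[r0 rt] L0|].
  have Qr := fluid_Q fluid_q r0; rewrite !sumN.
  have [h1 h2] := upset_drift lambda u_concave mu_gt0 alpha01 Qr J0 Aup AJ.
  have [/h1|/h2[-> ->]] := boolP (A (sigma u (q r))).
    by have := ler_wpM2l (ltW mu_gt0) arho; rewrite -lambdaE; lra.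
  by rewrite -/aA; lra.
rewrite !sumN subr0.
have V0 : 0 <= \sum_(p <- boxs n J) (A p)%:R * q 0 p.
  apply: sum_boxs_ge0 => p _.
  by rewrite mulr_ge0// (Q_ge0 (fluid_Q fluid_q (lexx 0))).
have := mulr_ge0 V0 (expR_ge0 (- (mu * t))); lra.
Qed.

(** Gronwall for minus the mass of [B], with target [- rho]. The strict inequality says that [B] is
    never full after [T], which excludes the case of [sigma] outside [B]. *)
Lemma fluid_retain (B : pred (idx n)) J T t :
  (0 < J)%N ->
  (forall p r, idx_pos p -> idx_pos r -> B p -> tri u p r -> B r) ->
  (forall p, idx_pos p -> B p -> (p.2 < J)%N) -> 0 <= T -> T <= t ->
  (forall r, T <= r -> \sum_(p <- boxs n J) (B p)%:R * q r p <
                       \sum_(p <- boxs n J) (B p)%:R * alpha p.1) ->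
  rho - \sum_(p <- boxs n J) (B p)%:R * q t p <= rho * expR (- (mu * (t - T))).
Proof.
move=> J0 Bup BJ T0 Tt lt.
have := @fluid_gronwall _ _ u lambda mu alpha mu_gt0 q fluid_q
  (fun p => - (B p)%:R) J T t (- rho) T0 Tt.
move=> /(_ _)/wrap[r /andP[Tr rt] L0|].
  have Qr := fluid_Q fluid_q (le_trans T0 Tr); rewrite !sumN.
  have [h1 h2] := upset_drift lambda u_concave mu_gt0 alpha01 Qr J0 Bup BJ.
  have [/h1|/h2[_ e]] := boolP (B (sigma u (q r))).
    by have := lambdaE; lra.
  by have := lt r Tr; rewrite e ltxx.
rewrite !sumN.
have V0 : 0 <= \sum_(p <- boxs n J) (B p)%:R * q T p.
  apply: sum_boxs_ge0 => p _.
  by rewrite mulr_ge0// (Q_ge0 (fluid_Q fluid_q T0)).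
have := mulr_ge0 V0 (expR_ge0 (- (mu * (t - T)))); lra.
Qed.

Lemma fluid_exponential_convergence : exists T C : R, forall t, T <= t ->
  (l1norm (fun p => q t p - qs p)%R <= (C * expR (- (mu * t)))%:E)%E.
Proof.
have rho0 := rho_ge0 lambda_gt0 mu_gt0; rewrite -/rho in rho0.
have [J [aA [J0 BJ aAE /andP[arho rhoa] qsE]]] :=
  q_star_spec u_concave alpha01 rho0.
have [s0 _ _] := sigma_starP u_concave alpha01 rho0.
set s := sigma_star u alpha rho in BJ aAE rhoa qsE s0.
pose A : pred (idx n) := tri u s.
pose B : pred (idx n) := fun p => (p == s) || tri u s p.
have sJ : (0 < s.2 <= J)%N by rewrite s0 ltnW ?BJ ?eqxx.
have AJ p : idx_pos p -> A p -> (p.2 < J)%N.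
  by move=> p0 Ap; apply: BJ => //; apply/orP; right.
have Aup p r : idx_pos p -> idx_pos r -> A p -> tri u p r -> A r.
  by move=> _ _; exact: tri_trans.
have sumB := sum_boxs_above_eq u _ sJ.
pose K0 := fine (l1norm (q 0)).
have K00 : 0 <= K0.
  apply: le_trans (Q_boxs_le (fluid_Q fluid_q (lexx 0)) 0).
  by apply: sum_boxs_ge0 => p _; exact: (Q_ge0 (fluid_Q fluid_q (lexx 0))).
pose d := aA + alpha s.1 - rho.
have d0 : 0 < d by rewrite /d; lra.
(* With [1 + x <= expR x] this yields [d * expR (mu * T) >= d + K0], so the excess mass is below the
   spare capacity [d] of [B] from time [T] on. *)
pose T := K0 / d / mu.
have T0 : 0 <= T by rewrite !divr_ge0 ?(ltW mu_gt0) ?(ltW d0).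
have mass := fluid_mass_le u_concave lambda_gt0 mu_gt0 alpha01 fluid_q.
have small t : T <= t -> K0 * expR (- (mu * t)) < d.
  move=> Tt; rewrite expRN ltr_pdivrMr ?expR_gt0//.
  apply: (@lt_le_trans _ _ (d * (1 + mu * T))).
    rewrite /T mulrCA divff ?gt_eqF// mulr1 mulrDr mulrCA divff ?gt_eqF//.
    by rewrite !mulr1; lra.
  rewrite ler_wpM2l ?(ltW d0)//; apply: le_trans (expR_ge1Dx _) _.
  by rewrite ler_expR ler_wpM2l// ltW.
have BsumS t : 0 <= t ->
    \sum_(p <- boxs n J) (B p)%:R * q t p <= rho + K0 * expR (- (mu * t)).
  move=> t0; apply: le_trans (mass J t t0); apply: ler_sum => p _.
  by rewrite ler_piMl ?(Q_ge0 (fluid_Q fluid_q t0))//; case: (B p).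
(* The deficit in [A] contributes [aA], the deviation at [s] contributes
   [aA + K0 + rho * expR (mu * T)], and the mass outside [B] contributes
   [K0 + rho * expR (mu * T)]. *)
exists T, (2 * aA + 2 * K0 + 2 * rho * expR (mu * T)) => t Tt.
have t0 := le_trans T0 Tt; have Qt := fluid_Q fluid_q t0.
have hA := fluid_fill J0 Aup AJ; rewrite -aAE in hA.
have {hA} hA := hA _ arho t0.
have hB : rho - \sum_(p <- boxs n J) (B p)%:R * q t p <=
    rho * expR (- (mu * (t - T))).
  apply: fluid_retain => //; first exact: B_upset.
  move=> r Tr; apply: (le_lt_trans (BsumS r (le_trans T0 Tr))).
  rewrite [ltRHS](sumB (fun p => alpha p.1)) -aAE.
  by have := small r Tr; rewrite /d; lra.
have hS := BsumS t t0.
have eT : expR (- (mu * (t - T))) = expR (mu * T) * expR (- (mu * t)).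
  by rewrite -expRD; congr expR; ring.
have qsE' p : idx_pos p -> `|q t p - qs p| =
   (A p)%:R * alpha p.1 - (A p)%:R * q t p +
   (p == s)%:R * `|q t s - (rho - aA)| + (q t p - (B p)%:R * q t p).
  move=> p0; rewrite /qs qsE /B -/(A p).
  move: (p0); rewrite /idx_pos /= lt0n => /negbTE ->.
  case: (boolP (A p)) => [Ap|nAp].
    rewrite orbT; have -> : (p == s) = false.
      by apply/negbTE/eqP => e; move: Ap; rewrite /A e tri_irr.
    rewrite distrC ger0_norm ?subr_ge0 ?(Q_le_alpha Qt)//=; ring.
  case: eqP => [->|_] /=; first by ring.
  by rewrite subr0 ger0_norm ?(Q_ge0 Qt)//; ring.
apply: esum_le_rows => [p|J']; first exact: normr_ge0.
rewrite big1 ?add0r => [|i _]; last first.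
  by rewrite (Q0 Qt) (_ : qs (i, 0%N) = alpha i) ?subrr ?normr0//.
pose M := maxn J J'.
apply: (le_trans (sum_boxs_leq (leq_maxr J J') (fun p _ => normr_ge0 _))).
rewrite (eq_sum_boxs (fun p p0 _ => qsE' p p0)) !big_split /= !sumrN -/M.
have toJ (C : pred (idx n)) f : (forall p, idx_pos p -> C p -> (p.2 < J)%N) ->
    \sum_(p <- boxs n M) (C p)%:R * f p =
    \sum_(p <- boxs n J) (C p)%:R * f p :> R.
  move=> CJ; apply/esym/sum_boxs_enlarge; first exact: leq_maxl.
  by move=> p p0 /(CJ p p0)/ltnW.
rewrite (toJ A (fun p => alpha p.1))// (toJ A (q t))// (toJ B (q t))// -aAE.
rewrite sum_boxs_pred1; last first.
  by case/andP: sJ => -> h; rewrite (leq_trans h) ?leq_maxl.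
have qB : \sum_(p <- boxs n J) (B p)%:R * q t p =
  \sum_(p <- boxs n J) (A p)%:R * q t p + q t s by exact: sumB.
have VA : \sum_(p <- boxs n J) (A p)%:R * q t p <= aA.
  by rewrite aAE; apply: ler_sum => p _; rewrite ler_wpM2l// (Q_le_alpha Qt).
have E0 := expR_ge0 (- (mu * t)).
have KE0 := mulr_ge0 K00 E0.
have aAE0 : 0 <= aA * expR (- (mu * t)) by lra.
have rE0 : 0 <= rho * (expR (mu * T) * expR (- (mu * t))).
  by apply: mulr_ge0 rho0 _; apply: mulr_ge0; exact: expR_ge0.
rewrite eT in hB.
(* The value at [s] is the mass of [B] minus that of [A]: the upper bound uses [hS] and [hA], the
   lower one [hB] and [VA]. *)
have habs : `|q t s - (rho - aA)| <=
    K0 * expR (- (mu * t)) + rho * (expR (mu * T) * expR (- (mu * t)))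
    + aA * expR (- (mu * t)).
  by rewrite ler_norml; apply/andP; split; lra.
have hM := mass M t t0; rewrite -/rho -/K0 in hM.
lra.
Qed.

End trajectory.

(** The constant trajectory at [x] has constant distance to [qs], which must equal its limit 0. *)
Lemma equilibrium_unique x : equilibrium u lambda mu alpha x ->
  (forall q, fluid_trajectory u lambda mu alpha q ->
    l1norm (fun p => q t p - qs p) @[t --> +oo] --> 0%E) -> x = qs.
Proof.
move=> [_ fx] /(_ _ fx) cv.
have l0 : l1norm (fun p => x p - qs p) = 0%E.
  by apply: (cvg_unique _ (cvg_cst _) cv); exact: ereal_hausdorff.
apply/funext => p; apply/eqP.
rewrite -subr_eq0 -normr_eq0 eq_le normr_ge0 andbT.
rewrite -lee_fin -[leRHS]l0; apply: esum_ge; exists [set p]; first by split.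
by rewrite fsbig_set1.
Qed.

Lemma fluid_cvg q : fluid_trajectory u lambda mu alpha q ->
  l1norm (fun p => q t p - qs p) @[t --> +oo] --> 0%E.
Proof.
move=> /fluid_exponential_convergence[T [C hC]].
have cv : (C * expR (- (mu * t)))%:E @[t --> +oo] --> 0%E.
  apply: cvg_EFin; first exact: nearW.
  rewrite -(mulr0 C); apply: (cvgM (cvg_cst _)).
  apply: (cvg_comp (fun t => mu * t) (fun t => expR (- t))).
    exact: gt0_cvgMry.
  exact: cvgr_expR.
apply: squeeze_cvge cv; last exact: cvg_cst.
near=> t; rewrite esum_ge0/=; last by move=> p _; rewrite lee_fin.
by apply: hC; near: t; exact: nbhs_pinfty_ge (num_real T).
Unshelve. all: by end_near. Qed.

End convergence.

Theorem theorem4 (R : realType) (n : nat) (u : 'I_n.+1 -> R -> R)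
    (lambda mu : R) (alpha : 'I_n.+1 -> R)
    (u_concave : forall i, concave_on_nneg (u i))
    (lambda_gt0 : 0 < lambda) (mu_gt0 : 0 < mu)
    (alpha01 : forall i, 0 < alpha i < 1)
    (alpha_sum : \sum_(i < n.+1) alpha i = 1) :
  let qs := q_star u alpha (lambda / mu) in
  [/\ equilibrium u lambda mu alpha qs,
      forall x, equilibrium u lambda mu alpha x -> x = qs &
      forall q : R -> idx n -> R, fluid_trajectory u lambda mu alpha q ->
        l1norm (fun p => q t p - qs p) @[t --> +oo] --> 0%E].
Proof.
split; first exact: equilibrium_q_star.
- by move=> x /equilibrium_unique; apply => // q; exact: fluid_cvg.
- by move=> q; exact: fluid_cvg.
Qed.
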